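(* Let $m\geq 1$ and $a$ be integers. Then for every $c\in(1,4/3)$ there exists $\varepsilon>0$ such that, uniformly for $x\geq 1$, \[ \left|\{n\leq x:\ s_Z(\lfloor n^c\rfloor)\equiv a\bmod m\}\right|=\frac xm+O\left(x^{1-\varepsilon}\right), \] where $n$ ranges over positive integers.
   Context: Let $F_0=0$, $F_1=1$, $F_k=F_{k-1}+F_{k-2}$ be the Fibonacci numbers. By Zeckendorf's theorem every positive integer $n$ has a unique representation $n=\sum_{i\geq 2}\varepsilon_i(n)F_i$ with $\varepsilon_i(n)\in\{0,1\}$ and $\varepsilon_i(n)=1\Rightarrow\varepsilon_{i+1}(n)=0$. The Zeckendorf sum-of-digits is $s_Z(n)=\sum_{i\geq 2}\varepsilon_i(n)$, with $s_Z(0)=0$. $\lfloor\cdot\rfloor$ is the floor function. *)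

(* Defs.v *)
From Stdlib Require Import Reals Lra Lia ZArith Arith List.
Open Scope R_scope.

Fixpoint fib (k : nat) : nat :=
  match k with
  | O => O
  | S k' => match k' with
            | O => 1%nat
            | S k'' => (fib k' + fib k'')%nat
            end
  end.

Fixpoint top_search (k n : nat) : nat :=
  match k with
  | O => O
  | S k' => if Nat.leb (fib k) n then k else top_search k' n
  end.

(* For n >= 1: the largest index i >= 2 with F_i <= n (note F_{n+2} > n). *)
Definition zeck_top (n : nat) : nat := top_search (n + 2) n.

(* Indices i (>= 2) with eps_i(n) = 1 in the Zeckendorf representation,
   computed by the greedy algorithm (which produces the unique Zeckendorf
   representation); fuel n suffices since each step decreases n. *)
Fixpoint zeck_indices_fuel (fuel n : nat) : list nat :=
  match fuel with
  | O => nil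
  | S f => if Nat.eqb n 0 then nil
           else zeck_top n :: zeck_indices_fuel f (n - fib (zeck_top n))
  end.

Definition zeck_indices (n : nat) : list nat := zeck_indices_fuel n n.

Definition zeck_digit (i n : nat) : nat :=
  if existsb (Nat.eqb i) (zeck_indices n) then 1%nat else 0%nat.

Definition sZ (n : nat) : nat := length (zeck_indices n).

Fixpoint zeck_valid (l : list nat) : Prop :=
  match l with
  | nil => True
  | i :: l' => (2 <= i)%nat /\
               match l' with nil => True | j :: _ => (j + 2 <= i)%nat end /\
               zeck_valid l'
  end.

Definition zeck_rep (l : list nat) (n : nat) : Prop :=
  zeck_valid l /\ fold_right (fun i s => (fib i + s)%nat) 0%nat l = n.

Definition nfloor (r : R) : nat := Z.to_nat (Int_part r).

Definition count_zeck (m a : Z) (c x : R) : nat :=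
  length (filter
    (fun n : nat => Z.eqb (Z.modulo (Z.of_nat (sZ (nfloor (Rpower (INR n) c)))) m)
                          (Z.modulo a m))
    (seq 1 (nfloor x))).

(* Main.v *)
(* The deviation of [s_Z mod m] from uniform distribution is measured by the real functions
   [psi m a k = 1_{s_Z k + a = 0 mod m} - 1/m]. By the Zeckendorf expansion the natural numbers are
   cut into consecutive blocks of length [F_l] or [F_(l-1)] on which [k |-> psi m a k] is, up to a
   change of [a], a fixed word [w] with small sum. While [n^c] crosses one block of length about
   [N^(c/2)], it is close to a linear function [al t + be]; hence the sum over the block only
   depends on [w], the slope [al] and the offset [be], apart from the few [n] for which [n^c] is
   close to an integer. Replacing [al] and [be] by nearby rationals with common denominator [Q]
   turns it into a sum of the dilated word [x |-> w (x / Q)] over a residue class [b mod p]. By an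
   elementary dispersion argument its mean square over [b mod p] and [P <= p < 2 P] is as small as
   for a random word. The slopes of the successive blocks are well spaced, so the mean square
   controls the sum over all blocks; taking the supremum over [b] costs a factor of the order of
   the slope, which is affordable precisely for [c < 4/3]. *)

Require Import Defs.
From Stdlib Require Import Reals ZArith Lia Lra Psatz Arith Bool List.
Open Scope R_scope.

(** * Finite sums *)

(** The dispersion estimate holds for every word bounded by 1, so [sZ] enters only through the block
    structure and the small sum of [psi] over a block: the small sum controls the mean over the
    residues [b], the dispersion controls the deviation from it. Averaging over [p] is what makes
    this elementary: the squares expand into autocorrelations at multiples of [p], whose average
    over a dyadic range of [p] reproduces the square of the mean up to a logarithm.

    The exponent 4/3 arises as follows. Let [A], of order N^(c-1), be the slope, [s] a tolerance
    slightly below 1, and [r], about N^(1-c/2), the number of [n] per block. Blocks have length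
    about A r, and there are about N / r of them. The pairs (p, b) admissible for one block form a
    box of about s Q / r moduli and s Q residues, while the total variance over about A Q moduli is
    about (A Q) (A r Q). Each modulus serves boundedly many blocks, so by Cauchy-Schwarz the total
    error z satisfies z^2 << (N / r) (A Q) (A r Q) r / (s Q)^2 = N A^2 r / s^2, which is close to
    N^(3c/2). It beats N^2 exactly for c < 4/3. *)

Fixpoint rsum (n : nat) (f : nat -> R) : R :=
  match n with
  | O => 0
  | S k => rsum k f + f k
  end.

Definition ind (b : bool) : R := if b then 1 else 0.

Lemma ind_bounds (b : bool) : 0 <= ind b <= 1.
Proof. destruct b; simpl; lra. Qed.

Lemma rsum_ext (n : nat) (f g : nat -> R) :
  (forall i, (i < n)%nat -> f i = g i) -> rsum n f = rsum n g.
Proof.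
  induction n as [|n IH]; intros H; simpl; [reflexivity|].
  rewrite IH, H by (try intros; try apply H; lia). reflexivity.
Qed.

Lemma rsum_le (n : nat) (f g : nat -> R) :
  (forall i, (i < n)%nat -> f i <= g i) -> rsum n f <= rsum n g.
Proof.
  induction n as [|n IH]; intros H; simpl; [lra|].
  apply Rplus_le_compat; [apply IH; intros; apply H; lia | apply H; lia].
Qed.

Lemma rsum_plus (n : nat) (f g : nat -> R) :
  rsum n (fun i => f i + g i) = rsum n f + rsum n g.
Proof. induction n as [|n IH]; simpl; [lra|]. rewrite IH; lra. Qed.

Lemma rsum_minus (n : nat) (f g : nat -> R) :
  rsum n (fun i => f i - g i) = rsum n f - rsum n g.
Proof. induction n as [|n IH]; simpl; [lra|]. rewrite IH; lra. Qed.

Lemma rsum_scal (n : nat) (c : R) (f : nat -> R) :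
  rsum n (fun i => c * f i) = c * rsum n f.
Proof. induction n as [|n IH]; simpl; [lra|]. rewrite IH; lra. Qed.

Lemma rsum_const (n : nat) (c : R) : rsum n (fun _ => c) = INR n * c.
Proof. induction n as [|n IH]; [simpl; lra|]. cbn [rsum]. rewrite IH, S_INR; lra. Qed.

Lemma rsum_0 (n : nat) (f : nat -> R) :
  (forall i, (i < n)%nat -> f i = 0) -> rsum n f = 0.
Proof.
  intros H. rewrite (rsum_ext n f (fun _ => 0)) by exact H.
  rewrite rsum_const; lra.
Qed.

Lemma rsum_nonneg (n : nat) (f : nat -> R) :
  (forall i, (i < n)%nat -> 0 <= f i) -> 0 <= rsum n f.
Proof.
  intros H. rewrite <- (rsum_0 n (fun _ => 0)) by reflexivity. apply rsum_le, H.
Qed.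

Lemma rsum_abs (n : nat) (f : nat -> R) :
  Rabs (rsum n f) <= rsum n (fun i => Rabs (f i)).
Proof.
  induction n as [|n IH]; simpl; [rewrite Rabs_R0; lra|].
  eapply Rle_trans; [apply Rabs_triang|]. lra.
Qed.

Lemma rsum_app (n k : nat) (f : nat -> R) :
  rsum (n + k) f = rsum n f + rsum k (fun i => f (n + i)%nat).
Proof.
  induction k as [|k IH]; [rewrite Nat.add_0_r; simpl; lra|].
  rewrite Nat.add_succ_r; simpl. rewrite IH; lra.
Qed.

Lemma rsum_head (n : nat) (f : nat -> R) :
  rsum (S n) f = f 0%nat + rsum n (fun i => f (S i)).
Proof. change (S n) with (1 + n)%nat. rewrite rsum_app; simpl; lra. Qed.

Lemma rsum_swap (n k : nat) (f : nat -> nat -> R) :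
  rsum n (fun i => rsum k (fun j => f i j)) = rsum k (fun j => rsum n (fun i => f i j)).
Proof.
  induction n as [|n IH]; simpl.
  - symmetry; apply rsum_0; reflexivity.
  - rewrite IH, <- rsum_plus. reflexivity.
Qed.

Lemma rsum_widen (n k : nat) (f : nat -> R) :
  (n <= k)%nat -> (forall i, (n <= i < k)%nat -> f i = 0) -> rsum k f = rsum n f.
Proof.
  intros Hnk H. replace k with (n + (k - n))%nat by lia.
  rewrite rsum_app, (rsum_0 (k - n)); [lra|]. intros; apply H; lia.
Qed.

Lemma rsum_le_widen (n k : nat) (f : nat -> R) :
  (n <= k)%nat -> (forall i, (n <= i < k)%nat -> 0 <= f i) -> rsum n f <= rsum k f.
Proof.
  intros Hnk H. replace k with (n + (k - n))%nat by lia.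
  rewrite rsum_app. enough (0 <= rsum (k - n) (fun i => f (n + i)%nat)) by lra.
  apply rsum_nonneg; intros; apply H; lia.
Qed.

Lemma rsum_term_le (n i : nat) (f : nat -> R) :
  (i < n)%nat -> (forall j, (j < n)%nat -> 0 <= f j) -> f i <= rsum n f.
Proof.
  intros Hi H. apply Rle_trans with (rsum (S i) f).
  - simpl. enough (0 <= rsum i f) by lra. apply rsum_nonneg; intros; apply H; lia.
  - apply rsum_le_widen; [lia|]. intros; apply H; lia.
Qed.

Lemma rsum_mul (n k : nat) (f : nat -> R) :
  rsum (n * k) f = rsum n (fun i => rsum k (fun j => f (i * k + j)%nat)).
Proof.
  induction n as [|n IH]; [reflexivity|].
  replace (S n * k)%nat with (n * k + k)%nat by lia.
  rewrite rsum_app, IH. reflexivity.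
Qed.

Lemma rsum_ind_range (n a k : nat) (f : nat -> R) :
  (a + k <= n)%nat ->
  rsum n (fun i => ind ((a <=? i) && (i <? a + k))%nat * f i)
  = rsum k (fun i => f (a + i)%nat).
Proof.
  intros H. replace n with (a + (k + (n - a - k)))%nat by lia.
  rewrite rsum_app, rsum_app.
  rewrite (rsum_0 a), (rsum_0 (n - a - k)).
  - rewrite Rplus_0_l, Rplus_0_r. apply rsum_ext; intros i Hi.
    rewrite (proj2 (Nat.leb_le _ _)), (proj2 (Nat.ltb_lt _ _)) by lia. simpl; lra.
  - intros i Hi. rewrite (proj2 (Nat.ltb_ge _ _)) by lia.
    rewrite andb_false_r; simpl; lra.
  - intros i Hi. rewrite (proj2 (Nat.leb_gt _ _)) by lia. simpl; lra.
Qed.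

Lemma rsum_ind_eq (n a : nat) (f : nat -> R) :
  (a < n)%nat -> rsum n (fun i => ind (i =? a)%nat * f i) = f a.
Proof.
  intros H.
  transitivity (rsum n (fun i => ind ((a <=? i) && (i <? a + 1))%nat * f i)).
  - apply rsum_ext; intros i Hi. f_equal. f_equal.
    destruct (Nat.eqb_spec i a), (Nat.leb_spec a i), (Nat.ltb_spec i (a + 1));
      simpl; try reflexivity; lia.
  - rewrite rsum_ind_range by lia. simpl. rewrite Nat.add_0_r; lra.
Qed.

Lemma cauchy_schwarz (n : nat) (f : nat -> R) :
  (rsum n f) ^ 2 <= INR n * rsum n (fun i => f i ^ 2).
Proof.
  induction n as [|n IH]; [simpl; lra|].
  cbn [rsum]. rewrite S_INR.
  (* Expanding these squares bounds the cross term [2 * f n * rsum n f] created by the new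
     summand. *)
  assert (H : 0 <= rsum n (fun i => (f i - f n) ^ 2))
    by (apply rsum_nonneg; intros; apply pow2_ge_0).
  rewrite (rsum_ext n _ (fun i => (f i ^ 2 - (2 * f n) * f i) + f n ^ 2)) in H
    by (intros; ring).
  rewrite rsum_plus, rsum_minus, rsum_scal, rsum_const in H. nra.
Qed.

(** The products y_i y_j are grouped by their lag j - i = r + 1. Since [y] vanishes from [T] on, all
    inner sums may run over the full range, without truncated index sets. *)
Lemma rsum_square (T : nat) (y : nat -> R) :
  (forall t, (T <= t)%nat -> y t = 0) ->
  (rsum T y) ^ 2 = rsum T (fun t => y t ^ 2)
    + 2 * rsum T (fun r => rsum T (fun t => y t * y (t + S r)%nat)).
Proof.
  revert y. induction T as [|T IH]; intros y Hy; [simpl; lra|].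
  assert (Hy' : forall t, (T <= t)%nat -> y (S t) = 0) by (intros; apply Hy; lia).
  specialize (IH (fun t => y (S t)) Hy'). cbv beta in IH.
  assert (E : rsum (S T) (fun r => rsum (S T) (fun t => y t * y (t + S r)%nat))
    = y 0%nat * rsum T (fun i => y (S i))
      + rsum T (fun r => rsum T (fun t => y (S t) * y (S (t + S r))))).
  { transitivity (rsum (S T) (fun r => y 0%nat * y (S r)
                    + rsum T (fun t => y (S t) * y (S (t + S r))))).
    { apply rsum_ext; intros r _. rewrite rsum_head. reflexivity. }
    rewrite rsum_plus, rsum_scal. cbn [rsum].
    rewrite (Hy (S T)) by lia.
    rewrite (rsum_0 T (fun t => y (S t) * y (S (t + S T)))).
    - ring.
    - intros i Hi. rewrite (Hy (S (i + S T))) by lia. ring. }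
  rewrite E, (rsum_head T y), (rsum_head T (fun t => y t ^ 2)).
  replace ((y 0%nat + rsum T (fun i => y (S i))) ^ 2)
    with (y 0%nat ^ 2 + 2 * y 0%nat * rsum T (fun i => y (S i))
          + (rsum T (fun i => y (S i))) ^ 2) by ring.
  rewrite IH. ring.
Qed.

(** The first index where [q] holds counts for the 1; all later ones lie within [mu] of it. *)
Lemma count_close (n : nat) (q : nat -> bool) (mu : R) :
  0 <= mu ->
  (forall i j, (i < j < n)%nat -> q i = true -> q j = true -> INR j - INR i <= mu) ->
  rsum n (fun i => ind (q i)) <= mu + 1.
Proof.
  revert q. induction n as [|n IH]; intros q Hmu H; [simpl; lra|].
  rewrite rsum_head. destruct (q 0%nat) eqn:E.
  - assert (B : rsum n (fun i => ind (q (S i))) <= mu).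
    { set (k := Z.to_nat (Int_part mu)).
      assert (Hk : INR k <= mu < INR k + 1).
      { unfold k. destruct (base_Int_part mu) as [H1 H2].
        assert (0 <= Int_part mu)%Z.
        { apply Z.lt_succ_r, lt_IZR. unfold Z.succ. rewrite plus_IZR. lra. }
        rewrite INR_IZR_INZ, Z2Nat.id by assumption. lra. }
      assert (C : forall j, (k <= j < n)%nat -> ind (q (S j)) = 0).
      { intros j Hj. destruct (q (S j)) eqn:Ej; [|reflexivity]. exfalso.
        specialize (H 0%nat (S j) ltac:(lia) E Ej).
        rewrite S_INR in H. simpl in H.
        assert (INR k <= INR j) by (apply le_INR; lia). lra. }
      apply Rle_trans with (INR k); [|lra].
      replace (INR k) with (rsum k (fun _ => 1)) by (rewrite rsum_const; lra).
      destruct (le_lt_dec k n) as [L|L].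
      - rewrite (rsum_widen k n) by assumption.
        apply rsum_le; intros; apply ind_bounds.
      - apply Rle_trans with (rsum n (fun _ => 1)).
        + apply rsum_le; intros; apply ind_bounds.
        + rewrite !rsum_const, !Rmult_1_r. apply le_INR; lia. }
    simpl; lra.
  - simpl ind. rewrite Rplus_0_l. apply IH; [assumption|].
    intros i j Hij Hi Hj. specialize (H (S i) (S j) ltac:(lia) Hi Hj).
    rewrite !S_INR in H. lra.
Qed.

Lemma Rabs_le_inv (x y : R) : Rabs x <= y -> - y <= x <= y.
Proof. unfold Rabs; destruct (Rcase_abs x); lra. Qed.

(** * The sum-of-digits function on Fibonacci blocks *)

Lemma fib_SS (k : nat) : fib (S (S k)) = (fib (S k) + fib k)%nat.
Proof. reflexivity. Qed.

Lemma fib_pos (k : nat) : (1 <= k)%nat -> (1 <= fib k)%nat.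
Proof.
  induction k as [|[|k] IH]; intros H; [lia|simpl; lia|].
  rewrite fib_SS. specialize (IH ltac:(lia)). lia.
Qed.

Lemma fib_le_S (k : nat) : (fib k <= fib (S k))%nat.
Proof. destruct k as [|k]; [simpl; lia|]. rewrite fib_SS. lia. Qed.

Lemma fib_mono (j k : nat) : (j <= k)%nat -> (fib j <= fib k)%nat.
Proof.
  induction 1 as [|k _ IH]; [lia|]. pose proof (fib_le_S k). lia.
Qed.

(** Crude growth, used to place the leading index inside the search range [n + 2] of [zeck_top] and
    to find Fibonacci numbers above a given bound. *)
Lemma fib_ge_pred (k : nat) : (k <= fib k + 1)%nat.
Proof.
  enough (H : (k <= fib k + 1 /\ S k <= fib (S k) + 1)%nat) by tauto.
  induction k as [|k [IH1 IH2]]; [simpl; lia|]. split; [lia|].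
  rewrite fib_SS. destruct k as [|k]; [simpl; lia|].
  pose proof (fib_pos (S k) ltac:(lia)). lia.
Qed.

Lemma fib_double (k : nat) : (1 <= k)%nat -> (fib (S k) <= 2 * fib k)%nat.
Proof.
  destruct k as [|k]; [lia|]. intros _. rewrite fib_SS.
  pose proof (fib_le_S k). lia.
Qed.

Lemma fib_le_pow2 (k j : nat) : (1 <= k)%nat -> (fib (k + j) <= 2 ^ j * fib k)%nat.
Proof.
  intros Hk. induction j as [|j IH]; [rewrite Nat.add_0_r; simpl; lia|].
  rewrite Nat.add_succ_r. pose proof (fib_double (k + j) ltac:(lia)). rewrite Nat.pow_succ_r'. nia.
Qed.

Lemma top_search_eq (K k n : nat) :
  (1 <= k <= K)%nat -> (fib k <= n)%nat ->
  (forall j, (k < j <= K)%nat -> (n < fib j)%nat) -> top_search K n = k.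
Proof.
  induction K as [|K IH]; intros Hk Hn Hj; [lia|]. cbn [top_search].
  destruct (Nat.eq_dec k (S K)) as [->|Hne].
  - rewrite (proj2 (Nat.leb_le _ _)) by assumption. reflexivity.
  - rewrite (proj2 (Nat.leb_gt _ _)) by (apply Hj; lia).
    apply IH; [lia|assumption|]. intros; apply Hj; lia.
Qed.

Lemma zeck_top_add (k u : nat) :
  (2 <= k)%nat -> (u < fib (k - 1))%nat -> zeck_top (fib k + u) = k.
Proof.
  intros Hk Hu. apply top_search_eq.
  - pose proof (fib_ge_pred k). lia.
  - lia.
  - intros j Hj. pose proof (fib_mono (S k) j ltac:(lia)).
    destruct k as [|k]; [lia|]. rewrite fib_SS in H.
    replace (S k - 1)%nat with k in Hu by lia. lia.
Qed.

(** Every greedy step subtracts something positive; hence any fuel that is at least [n] gives the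
    same digits. *)
Lemma fib_top_search_pos (K n : nat) :
  (1 <= K)%nat -> (1 <= n)%nat -> (1 <= fib (top_search K n))%nat.
Proof.
  induction K as [|K IH]; intros HK Hn; [lia|]. cbn [top_search].
  destruct (Nat.leb_spec (fib (S K)) n) as [H|H].
  - apply fib_pos; lia.
  - apply IH; [|assumption]. destruct K; [simpl in H; lia|lia].
Qed.

Lemma zeck_indices_fuel_irrel (f g n : nat) :
  (n <= f)%nat -> (n <= g)%nat -> zeck_indices_fuel f n = zeck_indices_fuel g n.
Proof.
  revert g n. induction f as [|f IH]; intros g n Hf Hg.
  - assert (n = 0%nat) as -> by lia. destruct g; reflexivity.
  - destruct g as [|g]; [assert (n = 0%nat) as -> by lia; reflexivity|].
    simpl. destruct (Nat.eqb_spec n 0) as [H|H]; [reflexivity|].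
    pose proof (fib_top_search_pos (n + 2) n ltac:(lia) ltac:(lia)).
    unfold zeck_top. rewrite (IH g) by lia. reflexivity.
Qed.

(** As fib k + u < fib (k+1), the greedy algorithm removes fib k first and is left with [u] itself.
    All block statements about [sZ] rest on this. *)
Lemma sZ_fib_add (k u : nat) :
  (2 <= k)%nat -> (u < fib (k - 1))%nat -> sZ (fib k + u) = S (sZ u).
Proof.
  intros Hk Hu. unfold sZ, zeck_indices.
  pose proof (fib_pos k ltac:(lia)).
  destruct (fib k + u)%nat as [|n] eqn:E; [lia|].
  cbn [zeck_indices_fuel]. simpl Nat.eqb. cbv iota.
  rewrite <- E, (zeck_top_add k u Hk Hu). cbn [length]. f_equal.
  replace (fib k + u - fib k)%nat with u by lia.
  f_equal. apply zeck_indices_fuel_irrel; lia.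
Qed.

(** The residue is added, not subtracted: fixing leading digits of total [s] then replaces [a] by
    [a + s], which stays inside [nat]. *)
Definition psi (m a k : nat) : R := ind ((sZ k + a) mod m =? 0)%nat - / INR m.

Lemma psi_abs (m a k : nat) : (1 <= m)%nat -> Rabs (psi m a k) <= 1.
Proof.
  intros Hm. unfold psi. pose proof (ind_bounds ((sZ k + a) mod m =? 0)%nat).
  assert (1 <= INR m) by (apply (le_INR 1); lia).
  assert (0 < / INR m) by (apply Rinv_0_lt_compat; lra).
  assert (/ INR m <= 1) by (rewrite <- Rinv_1; apply Rinv_le_contravar; lra).
  apply Rabs_le; lra.
Qed.

Lemma psi_shift (m a k l s : nat) : sZ k = (s + sZ l)%nat -> psi m a k = psi m (a + s) l.
Proof.
  intros H. unfold psi. rewrite H. do 4 f_equal. lia.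
Qed.

Lemma psi_mod (m a k : nat) : (1 <= m)%nat -> psi m (a mod m) k = psi m a k.
Proof.
  intros Hm. unfold psi. rewrite Nat.Div0.add_mod_idemp_r. reflexivity.
Qed.

Lemma rsum_residues (m b : nat) : (1 <= m)%nat ->
  rsum m (fun s => ind ((b + s) mod m =? 0)%nat) = 1.
Proof.
  intros Hm.
  (* The residue of -b; the outer [mod] sends the value m to 0 when m divides b. *)
  set (s0 := ((m - b mod m) mod m)%nat).
  assert (Hs0 : (s0 < m)%nat) by (apply Nat.mod_upper_bound; lia).
  rewrite (rsum_ext m _ (fun s => ind (s =? s0)%nat * 1)).
  - apply (rsum_ind_eq m s0 (fun _ => 1)); assumption.
  - intros s Hs. rewrite Rmult_1_r. f_equal. unfold s0.
    pose proof (Nat.mod_upper_bound b m ltac:(lia)) as Hb.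
    rewrite <- Nat.Div0.add_mod_idemp_l.
    destruct (Nat.eq_dec (b mod m) 0) as [E|E].
    + rewrite E, Nat.sub_0_r, Nat.Div0.mod_same. simpl.
      rewrite Nat.mod_small by lia. reflexivity.
    + rewrite (Nat.mod_small (m - b mod m)) by lia.
      destruct (le_lt_dec m (b mod m + s)) as [L|L].
      * replace (b mod m + s)%nat with ((b mod m + s - m) + 1 * m)%nat by lia.
        rewrite Nat.Div0.mod_add, Nat.mod_small by lia.
        apply Bool.eq_true_iff_eq. rewrite !Nat.eqb_eq. lia.
      * rewrite Nat.mod_small by lia.
        apply Bool.eq_true_iff_eq. rewrite !Nat.eqb_eq. lia.
Qed.

Lemma psi_residue_sum (m a k : nat) : (1 <= m)%nat ->
  rsum m (fun s => psi m (a + s) k) = 0.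
Proof.
  intros Hm. unfold psi. rewrite rsum_minus, rsum_const.
  rewrite (rsum_ext m _ (fun s => ind ((sZ k + a + s) mod m =? 0)%nat))
    by (intros; rewrite Nat.add_assoc; reflexivity).
  rewrite rsum_residues by assumption.
  field. apply not_0_INR; lia.
Qed.

(** * Cancellation of [psi] over Fibonacci intervals *)

Definition psi_sum (m a k : nat) : R := rsum (fib k) (psi m a).

(** The interval is cut at fib (k+1). Numbers above the cut have one additional leading digit, hence
    the shift of [a] by one. *)
Lemma psi_sum_rec (m a k : nat) :
  (1 <= k)%nat -> psi_sum m a (S (S k)) = psi_sum m a (S k) + psi_sum m (S a) k.
Proof.
  intros Hk. unfold psi_sum. rewrite fib_SS, rsum_app. f_equal.
  apply rsum_ext; intros u Hu. replace (S a) with (a + 1)%nat by lia.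
  apply psi_shift. apply sZ_fib_add; [lia|].
  replace (S k - 1)%nat with k by lia. assumption.
Qed.

Lemma psi_sum_residue_sum (m a k : nat) : (1 <= m)%nat ->
  rsum m (fun s => psi_sum m (a + s) k) = 0.
Proof.
  intros Hm. unfold psi_sum. rewrite rsum_swap. apply rsum_0.
  intros; apply psi_residue_sum; assumption.
Qed.

Lemma psi_sum_trivial (m a k : nat) : (1 <= m)%nat -> Rabs (psi_sum m a k) <= INR (fib k).
Proof.
  intros Hm. unfold psi_sum. eapply Rle_trans; [apply rsum_abs|].
  replace (INR (fib k)) with (rsum (fib k) (fun _ => 1)) by (rewrite rsum_const; lra).
  apply rsum_le; intros; apply psi_abs; assumption.
Qed.

(* Unfolding the recursion twice from level [n + 2 i] to level [n] produces, besides other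
   terms, the full string of shifts [0, ..., i]; once it exhausts the residues, it cancels. *)
Lemma psi_sum_expand (m n i : nat) (c : R) :
  (2 <= n)%nat ->
  (forall a k, (n - 1 <= k < n + 2 * i)%nat -> Rabs (psi_sum m a k) <= c * INR (fib k)) ->
  forall a,
  Rabs (psi_sum m a (n + 2 * i) - rsum (S i) (fun s => psi_sum m (a + s) n))
  <= c * (INR (fib (n + 2 * i)) - INR (S i) * INR (fib n)).
Proof.
  intros Hn H.
  assert (A : forall j, (j <= 2 * i)%nat -> forall a,
    Rabs (psi_sum m a (n + j) - psi_sum m a n) <= c * (INR (fib (n + j)) - INR (fib n))).
  { induction j as [|j IH]; intros Hj a.
    - rewrite Nat.add_0_r, !Rminus_diag, Rabs_R0. lra.
    - specialize (IH ltac:(lia) a).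
      destruct n as [|n]; [lia|]. replace (S n + S j)%nat with (S (S (n + j))) by lia.
      rewrite psi_sum_rec, fib_SS, plus_INR by lia.
      specialize (H (S a) (n + j)%nat ltac:(lia)).
      replace (S n + j)%nat with (S (n + j)) in IH by lia.
      apply Rabs_le_inv in H. apply Rabs_le_inv in IH. apply Rabs_le. lra. }
  induction i as [|i IH]; intros a.
  - simpl. rewrite !Nat.add_0_r. rewrite Rabs_right by lra. lra.
  - assert (H' : forall a k, (n - 1 <= k < n + 2 * i)%nat ->
              Rabs (psi_sum m a k) <= c * INR (fib k)) by (intros; apply H; lia).
    specialize (IH H' ltac:(intros; apply A; lia) (S a)).
    replace (n + 2 * S i)%nat with (S (S (n + 2 * i))) by lia.
    rewrite psi_sum_rec, fib_SS, plus_INR by lia.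
    specialize (A (S (2 * i)) ltac:(lia) a).
    replace (n + S (2 * i))%nat with (S (n + 2 * i)) in A by lia.
    rewrite (rsum_head (S i)), (S_INR (S i)), Nat.add_0_r.
    rewrite (rsum_ext (S i) _ (fun s => psi_sum m (S a + s) n))
      by (intros; f_equal; lia).
    apply Rabs_le_inv in A. apply Rabs_le_inv in IH. apply Rabs_le. lra.
Qed.

Lemma bernoulli (n : nat) (x : R) : 0 <= x <= 1 -> 1 - INR n * x <= (1 - x) ^ n.
Proof.
  intros Hx. induction n as [|n IH]; [simpl; lra|].
  rewrite S_INR. simpl pow.
  assert (0 <= INR n) by apply pos_INR.
  assert (0 <= INR n * x * x) by (repeat apply Rmult_le_pos; lra).
  assert ((1 - x) * (1 - INR n * x) <= (1 - x) * (1 - x) ^ n)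
    by (apply Rmult_le_compat_l; lra). lra.
Qed.

(** Strong induction that descends 2 (m - 1) levels at once, just enough for [psi_sum_expand] to
    produce all [m] shifts of level [n]. These cancel, and they would account for m fib n of the
    trivial bound fib k, which is a fixed proportion of it. *)
Lemma psi_sum_bound (m : nat) : (1 <= m)%nat ->
  exists C q : R, 0 < C /\ 0 < q < 1 /\
  forall a k, Rabs (psi_sum m a k) <= C * q ^ k * INR (fib k).
Proof.
  intros Hm.
  (* By Bernoulli this [x] gives q^(2m) >= 1 - 2^(-2m), and 2^(-2m) is a lower bound for the
     cancelled proportion because fib k <= 2^(2m) fib n. The choice of [C] makes the trivial bound
     sufficient for k <= 2m. *)
  set (x := / (INR (2 * m) * 2 ^ (2 * m))).
  set (q := 1 - x). set (C := / q ^ (2 * m)).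
  assert (Hm1 : 2 <= INR (2 * m)) by (apply (le_INR 2); lia).
  assert (Hp : 1 <= 2 ^ (2 * m)) by (apply pow_R1_Rle; lra).
  assert (Hx : 0 < x <= 1 / 2).
  { unfold x. split; [apply Rinv_0_lt_compat; nra|].
    replace (1 / 2) with (/ 2) by field. apply Rinv_le_contravar; nra. }
  assert (Hq : 0 < q < 1) by (unfold q; lra).
  assert (HC : 0 < C) by (apply Rinv_0_lt_compat, pow_lt; lra).
  exists C, q. split; [assumption|split; [assumption|]].
  intros a k. revert a. induction k as [k IH] using lt_wf_ind. intros a.
  destruct (le_lt_dec k (2 * m)) as [L|L].
  - eapply Rle_trans; [apply psi_sum_trivial; assumption|].
    assert (1 <= C * q ^ k).
    { unfold C. replace (2 * m)%nat with (k + (2 * m - k))%nat by lia.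
      rewrite pow_add, Rinv_mult.
      assert (0 < q ^ k) by (apply pow_lt; lra).
      replace (/ q ^ k * / q ^ (2 * m - k) * q ^ k) with (/ q ^ (2 * m - k))
        by (field; split; apply pow_nonzero; lra).
      rewrite <- Rinv_1. apply Rinv_le_contravar; [apply pow_lt; lra|].
      rewrite <- (pow1 (2 * m - k)). apply pow_incr; lra. }
    pose proof (pos_INR (fib k)). nra.
  - set (n := (k - 2 * (m - 1))%nat).
    assert (Hn : (3 <= n)%nat) by (unfold n; lia).
    pose proof (psi_sum_expand m n (m - 1) (C * q ^ (n - 1)) ltac:(lia)) as E.
    replace (n + 2 * (m - 1))%nat with k in E by (unfold n; lia).
    replace (S (m - 1)) with m in E by lia.
    assert (F : forall b j, (n - 1 <= j < k)%nat ->
              Rabs (psi_sum m b j) <= C * q ^ (n - 1) * INR (fib j)).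
    { intros b j Hj. eapply Rle_trans; [apply IH; lia|].
      apply Rmult_le_compat_r; [apply pos_INR|].
      apply Rmult_le_compat_l; [lra|].
      replace j with ((n - 1) + (j - (n - 1)))%nat by lia. rewrite pow_add.
      rewrite <- (Rmult_1_r (q ^ (n - 1))) at 2.
      apply Rmult_le_compat_l; [left; apply pow_lt; lra|].
      rewrite <- (pow1 (j - (n - 1))). apply pow_incr; lra. }
    specialize (E F a). rewrite psi_sum_residue_sum, Rminus_0_r in E by assumption.
    eapply Rle_trans; [apply E|].
    replace k with ((n - 1) + (2 * m - 1))%nat at 2 by (unfold n; lia).
    rewrite pow_add.
    assert (Q1 : 0 < q ^ (n - 1)) by (apply pow_lt; lra).
    rewrite Rmult_assoc, (Rmult_assoc C). apply Rmult_le_compat_l; [lra|].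
    rewrite Rmult_assoc. apply Rmult_le_compat_l; [lra|].
    assert (Q2 : 1 - / 2 ^ (2 * m) <= q ^ (2 * m - 1)).
    { apply Rle_trans with (q ^ (2 * m)).
      - eapply Rle_trans; [|apply bernoulli; lra].
        unfold x. rewrite Rinv_mult.
        replace (INR (2 * m) * (/ INR (2 * m) * / 2 ^ (2 * m))) with (/ 2 ^ (2 * m))
          by (field; split; [apply pow_nonzero|]; lra). lra.
      - replace (2 * m)%nat with (S (2 * m - 1)) at 1 by lia.
        assert (0 < q ^ (2 * m - 1)) by (apply pow_lt; lra).
        rewrite <- tech_pow_Rmult. nra. }
    assert (Q3 : INR (fib k) <= 2 ^ (2 * m) * INR (fib n)).
    { replace (2 ^ (2 * m)) with (INR (2 ^ (2 * m))).
      - rewrite <- mult_INR. apply le_INR.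
        pose proof (fib_le_pow2 n (2 * (m - 1)) ltac:(lia)) as H0.
        replace (n + 2 * (m - 1))%nat with k in H0 by (unfold n; lia).
        eapply Nat.le_trans; [exact H0|]. apply Nat.mul_le_mono_r.
        apply Nat.pow_le_mono_r; lia.
      - rewrite pow_INR. reflexivity. }
    assert (Q4 : INR (fib n) <= INR m * INR (fib n)).
    { pose proof (pos_INR (fib n)). assert (1 <= INR m) by (apply (le_INR 1); lia). nra. }
    assert (Q5 : / 2 ^ (2 * m) * INR (fib k) <= INR (fib n)).
    { apply Rmult_le_reg_l with (2 ^ (2 * m)); [lra|].
      rewrite <- Rmult_assoc, Rinv_r by lra. lra. }
    pose proof (pos_INR (fib k)). nra.
Qed.

Definition block_len (l : nat) (b : bool) : nat := if b then fib l else fib (l - 1).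

(** The [v i] are the block boundaries, [sh i] is the digit sum of the fixed leading part, and
    [ty i] tells the two lengths apart. The induction carries two consecutive levels, as the
    Fibonacci recursion requires. *)
Lemma zeckendorf_blocks (l j : nat) : (3 <= l)%nat ->
  exists (I : nat) (v sh : nat -> nat) (ty : nat -> bool),
    v 0%nat = 0%nat /\ v I = fib (l + j) /\
    forall i, (i < I)%nat ->
      v (S i) = (v i + block_len l (ty i))%nat /\
      forall u, (u < block_len l (ty i))%nat -> sZ (v i + u) = (sh i + sZ u)%nat.
Proof.
  intros Hl.
  set (P := fun k => exists (I : nat) (v sh : nat -> nat) (ty : nat -> bool),
    v 0%nat = 0%nat /\ v I = fib k /\
    forall i, (i < I)%nat ->
      v (S i) = (v i + block_len l (ty i))%nat /\
      forall u, (u < block_len l (ty i))%nat -> sZ (v i + u) = (sh i + sZ u)%nat).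
  assert (B : forall (k : nat) (b : bool), k = (if b then l else l - 1)%nat -> P k).
  { intros k b Hk. exists 1%nat, (fun i => if i =? 0 then 0 else fib k)%nat, (fun _ => 0%nat), (fun _ => b).
    split; [reflexivity|split; [reflexivity|]].
    intros i Hi. assert (i = 0%nat) as -> by lia. split.
    - simpl. unfold block_len. subst k. destruct b; reflexivity.
    - intros u Hu. reflexivity. }
  assert (Q : forall j, P (l + j)%nat /\ P (l + j - 1)%nat).
  { clear j. induction j as [|j [IH1 IH2]].
    - rewrite Nat.add_0_r. split; [apply (B l true)|apply (B (l - 1)%nat false)]; reflexivity.
    - split; [|replace (l + S j - 1)%nat with (l + j)%nat by lia; assumption].
      destruct IH1 as (I1 & v1 & s1 & t1 & V1 & E1 & H1).
      destruct IH2 as (I2 & v2 & s2 & t2 & V2 & E2 & H2).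
      set (k := (l + j)%nat) in *.
      assert (Hk : fib (l + S j) = (fib k + fib (k - 1))%nat).
      { replace (l + S j)%nat with (S (S (k - 1))) by (unfold k; lia). rewrite fib_SS.
        replace (S (k - 1)) with k by (unfold k; lia). reflexivity. }
      (* The partition of [0, fib k) is followed by that of [0, fib (k-1)) translated by fib k,
         whose leading parts contain one more digit. *)
      exists (I1 + I2)%nat,
        (fun i : nat => if i <? I1 then v1 i else fib k + v2 (i - I1))%nat,
        (fun i : nat => if i <? I1 then s1 i else S (s2 (i - I1)))%nat,
        (fun i : nat => if i <? I1 then t1 i else t2 (i - I1))%nat.
      (* Monotonicity keeps every block of the second partition below its end fib (k-1), the range
         in which [sZ_fib_add] applies. *)
      assert (M : forall d i, (i + d <= I2)%nat -> (v2 i <= v2 (i + d))%nat).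
      { induction d as [|d IHd]; intros i Hi; [rewrite Nat.add_0_r; lia|].
        specialize (IHd i ltac:(lia)). destruct (H2 (i + d)%nat ltac:(lia)) as [H3 _].
        rewrite Nat.add_succ_r. lia. }
      split; [|split].
      + destruct (Nat.ltb_spec 0 I1); [assumption|].
        assert (I1 = 0%nat) by lia. subst I1. simpl. rewrite V2. lia.
      + destruct (Nat.ltb_spec (I1 + I2) I1); [lia|].
        replace (I1 + I2 - I1)%nat with I2 by lia. lia.
      + intros i Hi. destruct (Nat.ltb_spec i I1) as [L|L].
        * destruct (H1 i L) as [G1 G2]. split; [|assumption].
          destruct (Nat.ltb_spec (S i) I1) as [L'|L']; [assumption|].
          assert (S i = I1) as <- by lia. rewrite Nat.sub_diag, V2. lia.
        * destruct (H2 (i - I1)%nat ltac:(lia)) as [G1 G2]. split.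
          -- destruct (Nat.ltb_spec (S i) I1) as [L'|L']; [lia|].
             replace (S i - I1)%nat with (S (i - I1)) by lia. lia.
          -- intros u Hu. rewrite <- Nat.add_assoc, sZ_fib_add.
             ++ rewrite G2 by assumption. reflexivity.
             ++ unfold k; lia.
             ++ pose proof (M (I2 - S (i - I1))%nat (S (i - I1)) ltac:(lia)) as M'.
                replace (S (i - I1) + (I2 - S (i - I1)))%nat with I2 in M' by lia. lia. }
  apply (Q j).
Qed.

(** * Variance along arithmetic progressions with varying modulus *)

Definition autocorr (X : nat) (W : nat -> R) (d : nat) : R :=
  rsum X (fun x => W x * W (x + d)%nat).

Definition ap_sum (W : nat -> R) (p T b : nat) : R := rsum T (fun t => W (b + p * t)%nat).

Definition ap_variance (X : nat) (W : nat -> R) (p T : nat) : R :=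
  rsum p (fun b => (ap_sum W p T b - rsum X W / INR p) ^ 2).

Lemma rsum_residue_classes (X p T : nat) (g : nat -> R) :
  (X <= p * T)%nat -> (forall x, (X <= x)%nat -> g x = 0) ->
  rsum p (fun b => rsum T (fun t => g (b + p * t)%nat)) = rsum X g.
Proof.
  intros HX Hg. rewrite rsum_swap, <- (rsum_widen X (T * p)), rsum_mul.
  - apply rsum_ext; intros t _. apply rsum_ext; intros b _. f_equal; lia.
  - lia.
  - intros; apply Hg; lia.
Qed.

(** Pairs in a common class mod [p] have lag a multiple of [p], while the square of the total sum
    involves all lags. The variance is the difference of the two, with the term -C(0) / p
    dropped. *)
Lemma ap_variance_le (X : nat) (W : nat -> R) (p T : nat) :
  (1 <= p)%nat -> (X <= p * T)%nat -> (forall x, (X <= x)%nat -> W x = 0) ->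
  ap_variance X W p T <= autocorr X W 0
    + 2 * (rsum T (fun r => autocorr X W (p * S r))
           - / INR p * rsum X (fun d => autocorr X W (S d))).
Proof.
  intros Hp HX HW. unfold ap_variance. set (M := rsum X W).
  assert (Hp' : 1 <= INR p) by (apply (le_INR 1); lia).
  rewrite (rsum_ext p _ (fun b => (ap_sum W p T b ^ 2 - (2 * (M / INR p)) * ap_sum W p T b)
             + (M / INR p) ^ 2)) by (intros; ring).
  rewrite rsum_plus, rsum_minus, rsum_scal, rsum_const.
  assert (E1 : rsum p (ap_sum W p T) = M).
  { unfold ap_sum. rewrite (rsum_residue_classes X p T W) by assumption. reflexivity. }
  assert (E2 : rsum p (fun b => ap_sum W p T b ^ 2)
    = autocorr X W 0 + 2 * rsum T (fun r => autocorr X W (p * S r))).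
  { rewrite (rsum_ext p _ (fun b => rsum T (fun t => W (b + p * t)%nat ^ 2)
       + 2 * rsum T (fun r => rsum T (fun t =>
              W (b + p * t)%nat * W (b + p * t + p * S r)%nat)))).
    - rewrite rsum_plus, rsum_scal. f_equal; [|f_equal].
      + rewrite (rsum_residue_classes X p T (fun x => W x ^ 2)).
        * apply rsum_ext; intros; rewrite Nat.add_0_r; ring.
        * assumption.
        * intros x Hx; rewrite HW by assumption; ring.
      + rewrite rsum_swap. apply rsum_ext; intros r _.
        apply (rsum_residue_classes X p T (fun x => W x * W (x + p * S r)%nat)).
        * assumption.
        * intros x Hx; rewrite HW by assumption; ring.
    - intros b _. unfold ap_sum. rewrite rsum_square.
      + f_equal. f_equal. apply rsum_ext; intros r _. apply rsum_ext; intros t _.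
        f_equal. f_equal. lia.
      + intros t Ht. apply HW. nia. }
  assert (E3 : M ^ 2 = autocorr X W 0 + 2 * rsum X (fun d => autocorr X W (S d))).
  { unfold M. rewrite rsum_square by assumption. f_equal.
    apply rsum_ext; intros; rewrite Nat.add_0_r; ring. }
  rewrite E1, E2.
  assert (C0 : 0 <= autocorr X W 0).
  { apply rsum_nonneg; intros; rewrite Nat.add_0_r. nra. }
  replace (INR p * (M / INR p) ^ 2) with (M ^ 2 * / INR p) by (field; lra).
  replace (2 * (M / INR p) * M) with (2 * (M ^ 2 * / INR p)) by (field; lra).
  assert (0 < / INR p) by (apply Rinv_0_lt_compat; lra).
  rewrite E3. nra.
Qed.

(** * Weights of the lags and alternating harmonic sums *)

Definition alt_harm (n : nat) : R := rsum n (fun i => (-1) ^ i * / INR (S i)).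

Lemma alt_harm_close (k n : nat) :
  0 <= (-1) ^ n * (alt_harm (n + k) - alt_harm n) <= / INR (S n).
Proof.
  revert n. induction k as [|k IH]; intros n.
  - rewrite Nat.add_0_r, Rminus_diag, Rmult_0_r. split; [lra|].
    left; apply Rinv_0_lt_compat, lt_0_INR; lia.
  - specialize (IH (S n)). replace (S n + k)%nat with (n + S k)%nat in IH by lia.
    unfold alt_harm in *. cbn [rsum] in IH. rewrite <- tech_pow_Rmult in IH.
    set (u := rsum (n + S k) _) in *. set (v := rsum n _) in *.
    assert (H : (-1) ^ n * (-1) ^ n = 1).
    { rewrite <- Rpow_mult_distr. replace (-1 * -1) with 1 by ring. apply pow1. }
    replace (-1 * (-1) ^ n * (u - (v + (-1) ^ n * / INR (S n))))
      with ((-1) ^ n * (-1) ^ n * / INR (S n) - (-1) ^ n * (u - v)) in IH by ring.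
    rewrite H in IH.
    assert (/ INR (S (S n)) <= / INR (S n)).
    { apply Rinv_le_contravar; [apply lt_0_INR; lia|]. apply le_INR; lia. }
    lra.
Qed.

Lemma alt_harm_dist (n n' : nat) :
  (n <= n')%nat -> Rabs (alt_harm n - alt_harm n') <= / INR (S n).
Proof.
  intros H. pose proof (alt_harm_close (n' - n) n) as A.
  replace (n + (n' - n))%nat with n' in A by lia.
  replace (Rabs (alt_harm n - alt_harm n'))
    with (Rabs ((-1) ^ n * (alt_harm n' - alt_harm n))).
  - rewrite Rabs_right; lra.
  - rewrite Rabs_mult, pow_1_abs, Rmult_1_l. apply Rabs_minus_sym.
Qed.

(** The classical identity of the sum of 1/r over n/2 < r <= n with 1 - 1/2 + 1/3 - ... up to the
    n-th term. It gives every lag weight as a partial sum of one convergent series, so two weights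
    can be compared by the Leibniz bound. *)
Lemma half_window_sum (T n : nat) : (n <= T)%nat ->
  rsum T (fun r => ind ((S r <=? n) && (n <? 2 * S r))%nat * / INR (S r)) = alt_harm n.
Proof.
  induction n as [|n IH]; intros Hn.
  - unfold alt_harm; simpl. apply rsum_0. intros; simpl; lra.
  - unfold alt_harm in *. cbn [rsum]. rewrite <- IH by lia.
    transitivity (rsum T (fun r => ind ((S r <=? n) && (n <? 2 * S r))%nat * / INR (S r))
      + (rsum T (fun r => ind (r =? n)%nat * / INR (S r))
         - rsum T (fun r => ind (2 * S r =? S n)%nat * / INR (S r)))).
    { rewrite <- rsum_minus, <- rsum_plus. apply rsum_ext; intros r _.
      enough (E : ind ((S r <=? S n) && (S n <? 2 * S r))%nat
        = ind ((S r <=? n) && (n <? 2 * S r))%nat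
          + (ind (r =? n)%nat - ind (2 * S r =? S n)%nat)) by (rewrite E; ring).
      destruct (Nat.leb_spec (S r) (S n)), (Nat.ltb_spec (S n) (2 * S r)),
        (Nat.leb_spec (S r) n), (Nat.ltb_spec n (2 * S r)),
        (Nat.eqb_spec r n), (Nat.eqb_spec (2 * S r) (S n)); simpl; try lra; lia. }
    f_equal.
    rewrite (rsum_ind_eq T n (fun r => / INR (S r))) by lia.
    (* Going from n to n + 1, the window gains 1/(n+1); it loses a term only when n + 1 is even,
       namely 2/(n+1). *)
    destruct (Nat.Even_or_Odd n) as [[k Hk]|[k Hk]].
    + rewrite (rsum_0 T).
      * rewrite Hk, pow_1_even. ring.
      * intros r _. rewrite (proj2 (Nat.eqb_neq _ _)) by lia. simpl; ring.
    + rewrite (rsum_ext T _ (fun r => ind (r =? k)%nat * / INR (S r))).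
      * rewrite (rsum_ind_eq T k (fun r => / INR (S r))) by lia.
        replace n with (S (2 * k)) at 2 by lia. rewrite pow_1_odd.
        replace (INR (S n)) with (2 * INR (S k)).
        -- field. apply not_0_INR; lia.
        -- replace (S n) with (2 * S k)%nat by lia. rewrite mult_INR. reflexivity.
      * intros r _. f_equal. f_equal. apply Bool.eq_true_iff_eq. rewrite !Nat.eqb_eq. lia.
Qed.

(** The range P <= p < 2P is itself the half window of 2P - 1, so the factor of the mean term
    belongs to the same series as the weights of the lags. *)
Lemma rsum_inv_dyadic (P : nat) : (1 <= P)%nat ->
  rsum P (fun j => / INR (P + j)) = alt_harm (2 * P - 1).
Proof.
  intros HP. rewrite <- (half_window_sum (2 * P)) by lia.
  transitivity (rsum (2 * P) (fun r => ind ((P - 1 <=? r) && (r <? P - 1 + P))%nat * / INR (S r))).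
  - rewrite rsum_ind_range by lia. apply rsum_ext; intros j _. f_equal. f_equal. lia.
  - apply rsum_ext; intros r Hr. f_equal. f_equal.
    apply Bool.eq_true_iff_eq. rewrite !andb_true_iff, !Nat.leb_le, !Nat.ltb_lt. lia.
Qed.

Definition harm (n : nat) : R := rsum n (fun i => / INR (S i)).

Lemma autocorr_abs (X d : nat) (W : nat -> R) :
  (forall x, Rabs (W x) <= 1) -> Rabs (autocorr X W d) <= INR X.
Proof.
  intros HW. unfold autocorr. eapply Rle_trans; [apply rsum_abs|].
  replace (INR X) with (rsum X (fun _ => 1)) by (rewrite rsum_const; lra).
  apply rsum_le; intros x _. rewrite Rabs_mult.
  pose proof (HW x). pose proof (HW (x + d)%nat).
  pose proof (Rabs_pos (W x)). pose proof (Rabs_pos (W (x + d)%nat)). nra.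
Qed.

Lemma autocorr_0 (X d : nat) (W : nat -> R) :
  (forall x, (X <= x)%nat -> W x = 0) -> (X <= d)%nat -> autocorr X W d = 0.
Proof.
  intros HW Hd. apply rsum_0. intros x _. rewrite (HW (x + d)%nat) by lia. ring.
Qed.

Lemma lipschitz_iter (g : nat -> R) (L : R) (d k : nat) :
  (forall d, Rabs (g (S d) - g d) <= L) -> Rabs (g (d + k)%nat - g d) <= INR k * L.
Proof.
  intros H. induction k as [|k IH].
  - rewrite Nat.add_0_r, Rminus_diag, Rabs_R0. simpl; lra.
  - rewrite Nat.add_succ_r, S_INR. specialize (H (d + k)%nat).
    apply Rabs_le_inv in H. apply Rabs_le_inv in IH. apply Rabs_le. lra.
Qed.

(* The multiples [p r] with [P <= p < 2 P] sample [r P, 2 r P) with step [r]; since [autocorr] is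
   slowly varying, their sum is [1 / r] times the full sum over that interval. Summing over [r],
   the value at [d] gets the weight [sum_{d / 2 P < r <= d / P} 1 / r], which is close to
   [sum_p 1 / p], so that the main terms cancel. *)
Lemma ap_variance_sum (X : nat) (W : nat -> R) (P T : nat) (L : R) :
  (1 <= P)%nat -> (X <= P * T)%nat -> (T <= 2 * P)%nat ->
  (forall x, (X <= x)%nat -> W x = 0) -> (forall x, Rabs (W x) <= 1) ->
  0 <= L -> (forall d, Rabs (autocorr X W (S d) - autocorr X W d) <= L) ->
  rsum P (fun j => ap_variance X W (P + j) T)
  <= INR P * INR X * (3 + 2 * harm T) + 2 * INR P * L * INR T ^ 2.
Proof.
  intros HP HX HR HW0 HW1 HL HLip.
  set (Cc := autocorr X W).
  set (h := rsum P (fun j => / INR (P + j))).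
  assert (Hh : h = alt_harm (2 * P - 1)) by (apply rsum_inv_dyadic; assumption).
  assert (A : rsum P (fun j => ap_variance X W (P + j) T)
    <= INR P * Cc 0%nat + 2 * (rsum T (fun r => rsum P (fun j => Cc ((P + j) * S r)%nat))
          - h * rsum X (fun d => Cc (S d)))).
  { eapply Rle_trans.
    - apply rsum_le; intros j Hj. apply ap_variance_le; [lia|nia|assumption].
    - fold Cc. rewrite rsum_plus, rsum_const, rsum_scal, rsum_minus, rsum_swap.
      unfold h. rewrite (rsum_ext P (fun i => / INR (P + i) * _)
        (fun i => rsum X (fun d => Cc (S d)) * / INR (P + i))) by (intros; ring).
      rewrite rsum_scal. lra. }
  (* Each sampled value is compared with the average over the next [S r] lags, at a cost of at most
     L T. *)
  assert (B : forall r, (r < T)%nat ->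
    rsum P (fun j => Cc ((P + j) * S r)%nat)
    <= / INR (S r) * rsum (P * S r) (fun e => Cc (P * S r + e)%nat) + INR P * L * INR T).
  { intros r Hr. rewrite rsum_mul, <- rsum_scal.
    replace (INR P * L * INR T) with (rsum P (fun _ => L * INR T))
      by (rewrite rsum_const; ring).
    rewrite <- rsum_plus. apply rsum_le; intros j Hj.
    assert (HS : 0 < INR (S r)) by (apply lt_0_INR; lia).
    apply Rmult_le_reg_l with (INR (S r)); [assumption|].
    rewrite Rmult_plus_distr_l, <- Rmult_assoc, Rinv_r, Rmult_1_l by lra.
    replace (INR (S r) * (L * INR T)) with (rsum (S r) (fun _ => L * INR T))
      by (rewrite rsum_const; ring).
    rewrite <- rsum_plus, <- (rsum_const (S r)). apply rsum_le; intros e He.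
    pose proof (lipschitz_iter Cc L ((P + j) * S r) e HLip) as K.
    replace (P * S r + (j * S r + e))%nat with ((P + j) * S r + e)%nat by lia.
    apply Rabs_le_inv in K.
    assert (INR e * L <= INR T * L)
      by (apply Rmult_le_compat_r; [assumption|apply le_INR; lia]). lra. }
  (* After exchanging the sums, the lag [d] collects 1/r from all r with r P <= d < 2 r P, a half
     window of d / P. *)
  assert (D : rsum T (fun r => / INR (S r) * rsum (P * S r) (fun e => Cc (P * S r + e)%nat))
    = rsum (P * T) (fun d => Cc d * alt_harm (d / P))).
  { transitivity (rsum T (fun r => rsum (2 * (P * T)) (fun d =>
       ind ((P * S r <=? d) && (d <? P * S r + P * S r))%nat * (/ INR (S r) * Cc d)))).
    { apply rsum_ext; intros r Hr. rewrite rsum_ind_range, rsum_scal by nia. reflexivity. }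
    rewrite rsum_swap, (rsum_widen (P * T)).
    - apply rsum_ext; intros d Hd.
      rewrite <- (half_window_sum T (d / P)).
      + rewrite <- rsum_scal. apply rsum_ext; intros r _.
        replace ((P * S r <=? d) && (d <? P * S r + P * S r))%nat
          with ((S r <=? d / P) && (d / P <? 2 * S r))%nat; [ring|].
        apply Bool.eq_true_iff_eq. rewrite !andb_true_iff, !Nat.leb_le, !Nat.ltb_lt.
        pose proof (Nat.div_mod_eq d P). pose proof (Nat.mod_upper_bound d P ltac:(lia)).
        split; intros [H1 H2]; split.
        * nia.
        * nia.
        * apply Nat.div_le_lower_bound; lia.
        * apply Nat.Div0.div_lt_upper_bound. lia.
      + apply Nat.lt_le_incl, Nat.Div0.div_lt_upper_bound. assumption.
    - lia.
    - intros d Hd. apply rsum_0; intros r _. unfold Cc.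
      rewrite autocorr_0 by (assumption || lia). ring. }
  assert (E : rsum X (fun d => Cc (S d)) = rsum (P * T) Cc - Cc 0%nat).
  { rewrite <- (rsum_widen X (P * T)).
    - pose proof (rsum_head (P * T) Cc) as H. cbn [rsum] in H.
      assert (Cc (P * T)%nat = 0) by (apply autocorr_0; assumption). lra.
    - assumption.
    - intros; apply autocorr_0; [assumption|lia]. }
  assert (C0 : Rabs (Cc 0%nat) <= INR X) by (apply autocorr_abs; assumption).
  (* The weights differ from [h] by at most 1 / (d/P + 1), which sums to P harm T. The hypothesis T
     <= 2P ensures d/P <= 2P - 1, the order needed for [alt_harm_dist]. *)
  assert (F : rsum (P * T) (fun d => Cc d * alt_harm (d / P)) - h * rsum (P * T) Cc
     <= INR X * (INR P * harm T)).
  { rewrite <- rsum_scal, <- rsum_minus.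
    replace (INR P * harm T) with (rsum (P * T) (fun d => / INR (S (d / P)))).
    - rewrite <- rsum_scal. apply rsum_le; intros d Hd.
      assert (Hdp : (d / P < T)%nat) by (apply Nat.Div0.div_lt_upper_bound; assumption).
      pose proof (alt_harm_dist (d / P) (2 * P - 1) ltac:(lia)) as K.
      rewrite <- Hh in K.
      replace (Cc d * alt_harm (d / P) - h * Cc d) with (Cc d * (alt_harm (d / P) - h)) by ring.
      eapply Rle_trans; [apply Rle_abs|]. rewrite Rabs_mult.
      apply Rmult_le_compat; try apply Rabs_pos; [apply autocorr_abs|]; assumption.
    - rewrite Nat.mul_comm, rsum_mul. unfold harm. rewrite <- rsum_scal.
      apply rsum_ext; intros i _. rewrite <- rsum_const.
      apply rsum_ext; intros j Hj. rewrite Nat.div_add_l, Nat.div_small, Nat.add_0_r by lia.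
      reflexivity. }
  assert (Hh1 : 0 <= h <= INR P).
  { unfold h. split.
    - apply rsum_nonneg; intros. left. apply Rinv_0_lt_compat, lt_0_INR; lia.
    - replace (INR P) with (rsum P (fun _ => 1)) by (rewrite rsum_const; lra).
      apply rsum_le; intros j _. rewrite <- Rinv_1. apply Rinv_le_contravar; [lra|].
      apply (le_INR 1); lia. }
  apply Rabs_le_inv in C0.
  assert (C0' : 0 <= Cc 0%nat).
  { apply rsum_nonneg; intros; rewrite Nat.add_0_r. nra. }
  assert (G : rsum T (fun r => rsum P (fun j => Cc ((P + j) * S r)%nat))
    <= rsum (P * T) (fun d => Cc d * alt_harm (d / P)) + INR T * (INR P * L * INR T)).
  { rewrite <- D, <- (rsum_const T), <- rsum_plus. apply rsum_le; assumption. }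
  (* The constant 3 collects P C(0) from the diagonal and 2 h C(0) from the lag 0 in the full
     sum. *)
  rewrite E in A. pose proof (pos_INR P).
  assert (h * Cc 0%nat <= INR P * INR X) by (apply Rmult_le_compat; lra).
  assert (INR P * Cc 0%nat <= INR P * INR X) by (apply Rmult_le_compat_l; lra).
  eapply Rle_trans; [apply A|]. lra.
Qed.

(** * Dilated words *)

Definition blow_up (Q l : nat) (w : nat -> R) (x : nat) : R :=
  if (x <? l * Q)%nat then w (x / Q)%nat else 0.

Lemma blow_up_abs (Q l : nat) (w : nat -> R) (x : nat) :
  (forall u, Rabs (w u) <= 1) -> Rabs (blow_up Q l w x) <= 1.
Proof.
  intros H. unfold blow_up. destruct (x <? l * Q)%nat; [apply H|]. rewrite Rabs_R0; lra.
Qed.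

Lemma blow_up_0 (Q l : nat) (w : nat -> R) (x : nat) :
  (l * Q <= x)%nat -> blow_up Q l w x = 0.
Proof. intros H. unfold blow_up. rewrite (proj2 (Nat.ltb_ge _ _)) by assumption. reflexivity. Qed.

Lemma blow_up_at (Q l : nat) (w : nat -> R) (k e : nat) :
  (k < l)%nat -> (e < Q)%nat -> blow_up Q l w (k * Q + e) = w k.
Proof.
  intros Hk He. unfold blow_up. rewrite (proj2 (Nat.ltb_lt _ _)) by nia.
  rewrite Nat.div_add_l, Nat.div_small, Nat.add_0_r by lia. reflexivity.
Qed.

Lemma blow_up_sum (Q l : nat) (w : nat -> R) :
  rsum (l * Q) (blow_up Q l w) = INR Q * rsum l w.
Proof.
  rewrite rsum_mul, <- rsum_scal. apply rsum_ext; intros k Hk.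
  rewrite <- rsum_const. apply rsum_ext; intros e He. apply blow_up_at; assumption.
Qed.

Lemma blow_up_variation (Q l : nat) (w : nat -> R) :
  (1 <= Q)%nat -> (forall u, Rabs (w u) <= 1) ->
  rsum (l * Q) (fun y => Rabs (blow_up Q l w (S y) - blow_up Q l w y)) <= 2 * INR l.
Proof.
  intros HQ H. rewrite rsum_mul.
  replace (2 * INR l) with (rsum l (fun _ => 2)) by (rewrite rsum_const; ring).
  apply rsum_le; intros k Hk. destruct Q as [|Q]; [lia|]. cbn [rsum].
  rewrite rsum_0.
  - rewrite Rplus_0_l.
    pose proof (blow_up_abs (S Q) l w (S (k * S Q + Q)) H) as H1.
    pose proof (blow_up_abs (S Q) l w (k * S Q + Q) H) as H2.
    apply Rabs_le_inv in H1. apply Rabs_le_inv in H2. apply Rabs_le. lra.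
  - intros e He. rewrite <- Nat.add_succ_r, !blow_up_at by lia.
    rewrite Rminus_diag. apply Rabs_R0.
Qed.

(** A dilated word jumps at most once per run of length [Q], so its total variation is at most 2 l
    for any [w] bounded by 1. This is small compared with the length l Q, which is the purpose of
    the dilation. *)
Lemma blow_up_lipschitz (Q l : nat) (w : nat -> R) (d : nat) :
  (1 <= Q)%nat -> (forall u, Rabs (w u) <= 1) ->
  Rabs (autocorr (l * Q) (blow_up Q l w) (S d) - autocorr (l * Q) (blow_up Q l w) d)
  <= 2 * INR l.
Proof.
  intros HQ H. set (W := blow_up Q l w). set (X := (l * Q)%nat).
  set (g := fun y => Rabs (W (S y) - W y)).
  assert (G0 : forall y, 0 <= g y) by (intros; apply Rabs_pos).
  unfold autocorr. rewrite <- rsum_minus.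
  eapply Rle_trans; [apply rsum_abs|].
  eapply Rle_trans; [|apply (blow_up_variation Q l w HQ H)].
  fold W X. change (fun y => Rabs (W (S y) - W y)) with g.
  apply Rle_trans with (rsum X (fun x => g (d + x)%nat)).
  - apply rsum_le; intros x _. unfold g.
    rewrite <- Rmult_minus_distr_l, Rabs_mult.
    replace (x + S d)%nat with (S (d + x)) by lia. rewrite (Nat.add_comm x d).
    rewrite <- (Rmult_1_l (Rabs (W (S (d + x)) - _))) at 2.
    apply Rmult_le_compat_r; [apply Rabs_pos|]. apply blow_up_abs; assumption.
  - apply Rle_trans with (rsum (d + X) g).
    + rewrite rsum_app. pose proof (rsum_nonneg d g (fun i _ => G0 i)). lra.
    + rewrite (rsum_widen X (d + X)); [lra|lia|].
      intros y Hy. unfold g, W. rewrite !blow_up_0 by (unfold X in Hy; lia).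
      rewrite Rminus_diag. apply Rabs_R0.
Qed.

Lemma blow_up_variance_sum (Q l P T : nat) (w : nat -> R) :
  (1 <= Q)%nat -> (1 <= P)%nat -> (l * Q <= P * T)%nat -> (T <= 2 * P)%nat ->
  (T * T <= Q)%nat -> (forall u, Rabs (w u) <= 1) ->
  rsum P (fun j => ap_variance (l * Q) (blow_up Q l w) (P + j) T)
  <= INR P * INR l * INR Q * (7 + 2 * harm T).
Proof.
  intros HQ HP HX HR HRQ Hw.
  eapply Rle_trans.
  - apply (ap_variance_sum (l * Q) (blow_up Q l w) P T (2 * INR l)); try assumption.
    + intros; apply blow_up_0; assumption.
    + intros; apply blow_up_abs; assumption.
    + pose proof (pos_INR l); lra.
    + intros; apply blow_up_lipschitz; assumption.
  (* The Lipschitz error 4 P l T^2 is at most 4 P l Q, which turns the 3 into 7. *)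
  - rewrite mult_INR. apply le_INR in HRQ. rewrite mult_INR in HRQ.
    assert (0 <= INR P * INR l) by (apply Rmult_le_pos; apply pos_INR).
    simpl pow. nra.
Qed.

(** * Values close to integers *)

Definition near_int (s y : R) : bool :=
  if Rle_dec (y - IZR (Int_part y)) s then true
  else if Rle_dec (1 - s) (y - IZR (Int_part y)) then true else false.

Lemma near_int_true (s y : R) : near_int s y = true -> exists z : Z, Rabs (y - IZR z) <= s.
Proof.
  unfold near_int. destruct (base_Int_part y) as [H1 H2].
  destruct (Rle_dec (y - IZR (Int_part y)) s) as [H|H]; intros E.
  - exists (Int_part y). rewrite Rabs_right; lra.
  - destruct (Rle_dec (1 - s) (y - IZR (Int_part y))) as [H'|H']; [|discriminate].
    exists (Int_part y + 1)%Z. rewrite plus_IZR, Rabs_left1; lra.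
Qed.

Lemma near_int_false (s y : R) : near_int s y = false ->
  IZR (Int_part y) + s < y < IZR (Int_part y) + 1 - s.
Proof.
  unfold near_int.
  destruct (Rle_dec (y - IZR (Int_part y)) s) as [H|H]; [discriminate|].
  destruct (Rle_dec (1 - s) (y - IZR (Int_part y))) as [H'|H']; [discriminate|]. lra.
Qed.

Lemma Int_part_add_INR (y : R) (k : nat) : Int_part (y + INR k) = (Int_part y + Z.of_nat k)%Z.
Proof.
  symmetry. apply Int_part_spec. rewrite plus_IZR, <- INR_IZR_INZ.
  destruct (base_Int_part y). lra.
Qed.

Lemma near_int_add_INR (s y : R) (k : nat) : near_int s (y + INR k) = near_int s y.
Proof.
  unfold near_int. rewrite Int_part_add_INR, plus_IZR, <- INR_IZR_INZ.
  replace (y + INR k - (IZR (Int_part y) + INR k)) with (y - IZR (Int_part y)) by ring.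
  reflexivity.
Qed.

Lemma Int_part_nonneg (y : R) : 0 <= y -> (0 <= Int_part y)%Z.
Proof.
  intros H. destruct (base_Int_part y) as [H1 H2].
  apply Z.lt_succ_r, lt_IZR. unfold Z.succ. rewrite plus_IZR. lra.
Qed.

Lemma INR_nfloor (y : R) : 0 <= y -> INR (nfloor y) = IZR (Int_part y).
Proof.
  intros H. unfold nfloor. rewrite INR_IZR_INZ, Z2Nat.id; [reflexivity|].
  apply Int_part_nonneg; assumption.
Qed.

Lemma nfloor_bounds (y : R) : 0 <= y -> INR (nfloor y) <= y < INR (nfloor y) + 1.
Proof.
  intros H. rewrite INR_nfloor by assumption. destruct (base_Int_part y). lra.
Qed.

Lemma nfloor_add_INR (y : R) (k : nat) : 0 <= y -> nfloor (y + INR k) = (k + nfloor y)%nat.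
Proof.
  intros H. pose proof (Int_part_nonneg y H).
  unfold nfloor. rewrite Int_part_add_INR, Z2Nat.inj_add, Nat2Z.id by lia. lia.
Qed.

Lemma telescope_bounds (g : nat -> R) (M i k : nat) (d d' : R) :
  (forall n, (n < M)%nat -> d <= g (S n) - g n <= d') -> (i + k <= M)%nat ->
  INR k * d <= g (i + k)%nat - g i <= INR k * d'.
Proof.
  intros H. induction k as [|k IH]; intros Hk.
  - rewrite Nat.add_0_r. simpl; lra.
  - specialize (IH ltac:(lia)). specialize (H (i + k)%nat ltac:(lia)).
    rewrite Nat.add_succ_r, S_INR. lra.
Qed.

(** First factor: the number of integers within reach of [g]. Second factor: the number of [n] with
    g n within s of one given integer, since [g] grows by at least [d] per step. *)
Lemma count_near_monotone (g : nat -> R) (q : nat -> bool) (M : nat) (d d' s : R) :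
  0 < d -> 0 <= s <= 1 / 2 ->
  (forall n, (n < M)%nat -> d <= g (S n) - g n <= d') ->
  (forall n, (n < M)%nat -> q n = true -> exists z : Z, Rabs (g n - IZR z) <= s) ->
  rsum M (fun n => ind (q n)) <= (INR M * d' + 3) * (2 * s / d + 1).
Proof.
  intros Hd Hs Hg Hq.
  destruct (Nat.eq_dec M 0) as [->|HM].
  { simpl. assert (0 < 2 * s / d + 1); [|lra].
    assert (0 <= 2 * s / d) by (apply Rle_mult_inv_pos; lra). lra. }
  assert (Hd' : d <= d') by (specialize (Hg 0%nat ltac:(lia)); lra).
  assert (HMd : 0 <= INR M * d') by (apply Rmult_le_pos; [apply pos_INR|lra]).
  set (z0 := Int_part (g 0%nat)).
  destruct (base_Int_part (g 0%nat)) as [Z1 Z2]. fold z0 in Z1, Z2.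
  set (J := (3 + nfloor (INR M * d'))%nat).
  pose proof (nfloor_bounds _ HMd) as HJ.
  set (cl := fun n j => if Rle_dec (Rabs (g n - (IZR z0 + INR j))) s then true else false).
  assert (C : forall n, (n < M)%nat -> ind (q n) <= rsum J (fun j => ind (cl n j))).
  { intros n Hn. destruct (q n) eqn:E.
    - destruct (Hq n Hn E) as [z Hz].
      pose proof (telescope_bounds g M 0 n d d' Hg ltac:(lia)) as T. rewrite Nat.add_0_l in T.
      pose proof Hz as Hz'. apply Rabs_le_inv in Hz'.
      assert (0 <= INR n * d) by (apply Rmult_le_pos; [apply pos_INR|lra]).
      assert (INR n * d' <= INR M * d')
        by (apply Rmult_le_compat_r; [lra|apply le_INR; lia]).
      assert (L1 : (z0 <= z)%Z).
      { apply Z.lt_succ_r, lt_IZR. unfold Z.succ. rewrite plus_IZR. lra. }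
      set (j := Z.to_nat (z - z0)).
      assert (Ej : IZR z = IZR z0 + INR j).
      { unfold j. rewrite INR_IZR_INZ, Z2Nat.id, minus_IZR by lia. ring. }
      assert (L2 : (j < J)%nat).
      { apply INR_lt. unfold J. rewrite plus_INR. simpl (INR 3). lra. }
      apply Rle_trans with (ind (cl n j)).
      + unfold cl. rewrite <- Ej. destruct (Rle_dec _ s); [simpl; lra|contradiction].
      + apply (rsum_term_le J j (fun j => ind (cl n j))); [assumption|].
        intros; apply ind_bounds.
    - apply rsum_nonneg; intros; apply ind_bounds. }
  eapply Rle_trans; [apply rsum_le, C|]. rewrite rsum_swap.
  apply Rle_trans with (rsum J (fun _ => 2 * s / d + 1)).
  - apply rsum_le; intros j _. apply (count_close M (fun n => cl n j)).
    + apply Rle_mult_inv_pos; lra.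
    + intros i k Hik Hi Hk. unfold cl in Hi, Hk.
      destruct (Rle_dec (Rabs (g i - _)) s) as [Gi|]; [|discriminate].
      destruct (Rle_dec (Rabs (g k - _)) s) as [Gk|]; [|discriminate].
      apply Rabs_le_inv in Gi. apply Rabs_le_inv in Gk.
      pose proof (telescope_bounds g M i (k - i) d d' Hg ltac:(lia)) as T.
      replace (i + (k - i))%nat with k in T by lia. rewrite minus_INR in T by lia.
      apply Rmult_le_reg_r with d; [assumption|].
      replace (2 * s / d * d) with (2 * s) by (field; lra). lra.
  - rewrite rsum_const. apply Rmult_le_compat_r.
    + assert (0 <= 2 * s / d) by (apply Rle_mult_inv_pos; lra). lra.
    + unfold J. rewrite plus_INR. simpl (INR 3). lra.
Qed.

(** With S the count, S^2 is S plus twice the number of pairs, and S^2 >= 2 S - 1. *)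
Lemma count_le_pairs (k : nat) (q : nat -> bool) :
  rsum k (fun n => ind (q n))
  <= 1 + 2 * rsum k (fun r => rsum k (fun n => ind (q n && q (n + S r)%nat))).
Proof.
  set (y := fun n => if (n <? k)%nat then ind (q n) else 0).
  assert (Hy : forall n, (n < k)%nat -> y n = ind (q n)).
  { intros n Hn. unfold y. rewrite (proj2 (Nat.ltb_lt _ _)) by assumption. reflexivity. }
  pose proof (rsum_square k y) as H.
  rewrite (rsum_ext k y (fun n => ind (q n))) in H by assumption.
  rewrite (rsum_ext k (fun t => y t ^ 2) (fun n => ind (q n))) in H.
  - set (S := rsum k (fun n => ind (q n))) in *.
    assert (L : rsum k (fun r => rsum k (fun t => y t * y (t + Datatypes.S r)%nat))
      <= rsum k (fun r => rsum k (fun n => ind (q n && q (n + Datatypes.S r)%nat)))).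
    { apply rsum_le; intros r _. apply rsum_le; intros n Hn. rewrite Hy by assumption.
      unfold y. destruct (n + Datatypes.S r <? k)%nat, (q n), (q (n + Datatypes.S r)%nat);
        simpl; lra. }
    assert (E : S ^ 2 = S + 2 * rsum k (fun r => rsum k (fun t => y t * y (t + Datatypes.S r)%nat))).
    { apply H. intros t Ht. unfold y. rewrite (proj2 (Nat.ltb_ge _ _)) by assumption.
      reflexivity. }
    pose proof (pow2_ge_0 (S - 1)). nra.
  - intros n Hn. rewrite Hy by assumption. destruct (q n); simpl; ring.
Qed.

(* If [f n] and [f (n + r)] are both close to integers, then so is [f (n + r) - f n], which is a
   slowly increasing function of [n]. *)
Lemma near_int_count (f : nat -> R) (N nb T : nat) (k k' s : R) :
  0 < k -> 0 <= s <= 1 / 4 ->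
  (forall n, (N <= n < N + nb * T + T)%nat -> k <= f (S (S n)) - 2 * f (S n) + f n <= k') ->
  rsum (nb * T) (fun n => ind (near_int s (f (N + n)%nat)))
  <= INR nb + 2 * INR T * (4 * INR (nb * T) * s * (k' / k) + INR (nb * T) * INR T * k'
                           + 12 * s / k + 3).
Proof.
  intros Hk Hs Hf. set (q := fun n => near_int s (f (N + n)%nat)).
  change (fun n => ind (near_int s (f (N + n)%nat))) with (fun n => ind (q n)).
  destruct (Nat.eq_dec (nb * T) 0) as [E0|E0].
  { rewrite E0. cbn [rsum INR]. pose proof (pos_INR nb). pose proof (pos_INR T).
    assert (0 <= 12 * s / k) by (apply Rle_mult_inv_pos; lra).
    assert (0 <= 2 * INR T * (12 * s / k + 3)) by (apply Rmult_le_pos; lra). lra. }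
  assert (Hk' : k <= k') by (specialize (Hf N ltac:(lia)); lra).
  apply Rle_trans with (INR nb + 2 * rsum T (fun r => rsum (nb * T) (fun n =>
     ind (q n && q (n + S r)%nat)))).
  - rewrite rsum_mul.
    replace (rsum T (fun r => rsum (nb * T) (fun n => ind (q n && q (n + S r)%nat))))
      with (rsum nb (fun i => rsum T (fun r => rsum T (fun n =>
              ind (q (i * T + n)%nat && q (i * T + n + S r)%nat))))).
    + rewrite <- (Rmult_1_r (INR nb)), <- rsum_const, <- rsum_scal, <- rsum_plus.
      apply rsum_le; intros i _.
      eapply Rle_trans; [apply (count_le_pairs T (fun j => q (i * T + j)%nat))|].
      right. f_equal. f_equal. apply rsum_ext; intros r _. apply rsum_ext; intros n _.
      rewrite Nat.add_assoc. reflexivity.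
    + rewrite rsum_swap. apply rsum_ext; intros r _. rewrite rsum_mul. reflexivity.
  - apply Rplus_le_compat_l. rewrite Rmult_assoc. apply Rmult_le_compat_l; [lra|].
    rewrite <- rsum_const. apply rsum_le; intros r Hr.
    assert (HS : 1 <= INR (S r)) by (apply (le_INR 1); lia).
    assert (HS' : INR (S r) <= INR T) by (apply le_INR; lia).
    eapply Rle_trans.
    (* Two tolerances add up to 2 s; the increments of the lagged difference are sums of [S r]
       second differences of [f]. *)
    + apply (count_near_monotone (fun n => f (N + n + S r)%nat - f (N + n)%nat) _ (nb * T)
               (INR (S r) * k) (INR (S r) * k') (2 * s)).
      * apply Rmult_lt_0_compat; lra.
      * lra.
      * intros n Hn.
        pose proof (telescope_bounds (fun i => f (S (N + n + i)) - f (N + n + i)%nat) (S r) 0 (S r) k k') as H.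
        cbv beta in H. rewrite Nat.add_0_l, Nat.add_0_r in H.
        replace (N + S n + S r)%nat with (S (N + n + S r)) by lia.
        replace (N + S n)%nat with (S (N + n)) by lia.
        enough (INR (S r) * k <= f (S (N + n + S r)) - f (N + n + S r)%nat
                  - (f (S (N + n)) - f (N + n)%nat) <= INR (S r) * k') by lra.
        apply H; [|lia]. intros i Hi. specialize (Hf (N + n + i)%nat ltac:(lia)).
        rewrite Nat.add_succ_r. lra.
      * intros n Hn E. apply andb_true_iff in E. destruct E as [E1 E2].
        apply near_int_true in E1. apply near_int_true in E2.
        destruct E1 as [z1 H1]. destruct E2 as [z2 H2]. exists (z2 - z1)%Z.
        rewrite minus_IZR. replace (N + n + S r)%nat with (N + (n + S r))%nat by lia.
        apply Rabs_le_inv in H1. apply Rabs_le_inv in H2. apply Rabs_le. lra.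
    + set (M := INR (nb * T)). assert (HM : 0 <= M) by apply pos_INR.
      replace ((M * (INR (S r) * k') + 3) * (2 * (2 * s) / (INR (S r) * k) + 1))
        with (4 * M * s * (k' / k) + M * INR (S r) * k' + 12 * s / k * / INR (S r) + 3)
        by (field; lra).
      assert (M * INR (S r) * k' <= M * INR T * k').
      { apply Rmult_le_compat_r; [lra|]. apply Rmult_le_compat_l; assumption. }
      assert (12 * s / k * / INR (S r) <= 12 * s / k).
      { rewrite <- (Rmult_1_r (12 * s / k)) at 2. apply Rmult_le_compat_l.
        - apply Rle_mult_inv_pos; lra.
        - rewrite <- Rinv_1. apply Rinv_le_contravar; lra. }
      lra.
Qed.

(** * Approximation by Beatty sequences *)

(** Away from integers, y t and its approximant (b + p t) / Q have the same floor, and there the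
    dilated word takes the value of [w] at this floor. *)
Lemma block_compare (y w : nat -> R) (l Q n T p b : nat) (s : R) :
  (1 <= Q)%nat -> 0 < s -> (forall u, Rabs (w u) <= 1) ->
  (forall t, (t <= n)%nat -> 0 <= y t) ->
  (forall t, (t < n)%nat -> y t < INR l) -> INR l <= y n ->
  (forall t, (t <= n)%nat -> Rabs (y t - INR (b + p * t) / INR Q) < s) ->
  s * INR Q <= INR p -> (n + 1 <= T)%nat ->
  Rabs (rsum n (fun t => w (nfloor (y t))))
  <= 2 * rsum n (fun t => ind (near_int s (y t))) + 1
     + Rabs (ap_sum (blow_up Q l w) p T b).
Proof.
  intros HQ Hs Hw Hy0 Hyl Hyn Hclose Hp HT.
  assert (HQ' : 1 <= INR Q) by (apply (le_INR 1); lia).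
  set (V := fun t => blow_up Q l w (b + p * t)).
  assert (HV : forall t, Rabs (V t) <= 1) by (intros; apply blow_up_abs; assumption).
  (* At t = n the approximant may still lie below l, by less than s, which costs the 1 in the bound.
     Every later step adds p / Q >= s and leaves the support. *)
  assert (E : ap_sum (blow_up Q l w) p T b = rsum n V + V n).
  { unfold ap_sum. fold V. change (rsum T V = rsum (S n) V). apply rsum_widen; [lia|].
    intros t Ht. apply blow_up_0. apply INR_le.
    specialize (Hclose n ltac:(lia)). apply Rabs_def2 in Hclose. destruct Hclose as [H _].
    assert (H1 : INR l - s < INR (b + p * n) / INR Q) by lra.
    apply (Rmult_lt_compat_r (INR Q)) in H1; [|lra].
    replace (INR (b + p * n) / INR Q * INR Q) with (INR (b + p * n)) in H1 by (field; lra).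
    assert (H2 : INR (b + p * n) + INR p <= INR (b + p * t))
      by (rewrite <- plus_INR; apply le_INR; nia).
    rewrite mult_INR. lra. }
  assert (D : Rabs (rsum n (fun t => w (nfloor (y t))) - rsum n V)
     <= 2 * rsum n (fun t => ind (near_int s (y t)))).
  { rewrite <- rsum_minus, <- rsum_scal. eapply Rle_trans; [apply rsum_abs|].
    apply rsum_le; intros t Ht. destruct (near_int s (y t)) eqn:En.
    - pose proof (Hw (nfloor (y t))) as H1. pose proof (HV t) as H2.
      apply Rabs_le_inv in H1. apply Rabs_le_inv in H2. simpl. apply Rabs_le. lra.
    - apply near_int_false in En. rewrite <- INR_nfloor in En by (apply Hy0; lia).
      set (k := nfloor (y t)) in *.
      assert (Hk : (k < l)%nat).
      { apply INR_lt. specialize (Hyl t Ht). lra. }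
      specialize (Hclose t ltac:(lia)). apply Rabs_def2 in Hclose.
      set (x := (b + p * t)%nat) in *.
      assert (H1 : INR k < INR x / INR Q) by lra.
      assert (H2 : INR x / INR Q < INR k + 1) by lra.
      apply (Rmult_lt_compat_r (INR Q)) in H1; [|lra].
      apply (Rmult_lt_compat_r (INR Q)) in H2; [|lra].
      replace (INR x / INR Q * INR Q) with (INR x) in H1, H2 by (field; lra).
      rewrite <- S_INR, <- mult_INR in H2. rewrite <- mult_INR in H1.
      apply INR_lt in H1, H2.
      assert (Ev : V t = w k).
      { unfold V. fold x. replace x with (k * Q + (x - k * Q))%nat by lia.
        apply blow_up_at; lia. }
      rewrite Ev, Rminus_diag, Rabs_R0. simpl; lra. }
  rewrite E. pose proof (HV n) as H1. apply Rabs_le_inv in H1.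
  apply Rabs_le_inv in D.
  pose proof (Rle_abs (rsum n V + V n)). pose proof (Rle_abs (- (rsum n V + V n))).
  rewrite Rabs_Ropp in H0. apply Rabs_le. lra.
Qed.

(* All slopes [p / Q] and offsets [b / Q] in a small box approximate the sequence equally well,
   so that the best of them can be replaced by the mean square. *)
Lemma block_variance (y w : nat -> R) (l Q n K W P : nat) (al k' s tau : R) :
  (1 <= Q)%nat -> (1 <= P)%nat -> 0 < s -> (forall u, Rabs (w u) <= 1) ->
  (forall t, (t <= n)%nat -> 0 <= y t) ->
  (forall t, (t < n)%nat -> y t < INR l) -> INR l <= y n ->
  (forall t, (t <= n)%nat -> 0 <= y t - y 0%nat - al * INR t <= k' * INR t ^ 2) ->
  0 <= k' -> y 0%nat <= al ->
  (n + 1 <= K)%nat -> INR K * (INR W + 1) <= s * INR Q / 4 -> k' * INR K ^ 2 <= s / 4 ->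
  (W * K <= P)%nat -> INR P <= al * INR Q -> s * INR Q <= INR P ->
  Rabs (rsum l w) <= tau ->
  let z := Rmax 0 (Rabs (rsum n (fun t => w (nfloor (y t))))
      - 2 * rsum n (fun t => ind (near_int s (y t))) - 1 - INR Q * tau / INR P) in
  INR W * (INR (W * K) * z ^ 2)
  <= rsum W (fun j => ap_variance (l * Q) (blow_up Q l w) (S (nfloor (al * INR Q)) + j) K).
Proof.
  intros HQ HP Hs Hw Hy0 Hyl Hyn Hlin Hk' Hal HnK HKW HkK HWP HPa HsP Htau z.
  assert (HQ' : 1 <= INR Q) by (apply (le_INR 1); lia).
  assert (HP' : 1 <= INR P) by (apply (le_INR 1); lia).
  assert (HalQ : 0 <= al * INR Q) by lra.
  assert (Hy00 : 0 <= y 0%nat) by (apply Hy0; lia).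
  assert (HyQ : 0 <= y 0%nat * INR Q) by (apply Rmult_le_pos; lra).
  assert (HyQ' : y 0%nat * INR Q <= al * INR Q) by (apply Rmult_le_compat_r; lra).
  pose proof (nfloor_bounds _ HalQ) as Ha. pose proof (nfloor_bounds _ HyQ) as Hb.
  set (p0 := S (nfloor (al * INR Q))). set (B := (W * K)%nat).
  (* The offsets are taken around and below y(0) Q, so that they stay below p: y(0) <= al gives y(0)
     Q < p, and if the subtraction is truncated to 0, then B <= P <= p suffices. *)
  set (b0 := (nfloor (y 0%nat * INR Q) - B)%nat).
  assert (Hp0 : al * INR Q < INR p0 <= al * INR Q + 1) by (unfold p0; rewrite S_INR; lra).
  assert (HPp0 : (P <= p0)%nat) by (apply INR_le; lra).
  assert (Hb0p : (b0 + B <= p0)%nat).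
  { destruct (le_lt_dec B (nfloor (y 0%nat * INR Q))) as [L|L].
    - unfold b0. replace (nfloor (y 0%nat * INR Q) - B + B)%nat with (nfloor (y 0%nat * INR Q)) by lia.
      apply INR_le. lra.
    - unfold b0. unfold B in *. lia. }
  rewrite <- rsum_const. apply rsum_le; intros j Hj.
  set (p := (p0 + j)%nat).
  assert (Hp : al * INR Q < INR p <= al * INR Q + INR W).
  { unfold p. rewrite plus_INR. pose proof (pos_INR j).
    assert (INR (S j) <= INR W) by (apply le_INR; lia). rewrite S_INR in H0. lra. }
  assert (HPp : INR P <= INR p) by lra.
  set (X := (l * Q)%nat). set (G := blow_up Q l w).
  unfold ap_variance. set (Mp := rsum X G / INR p).
  assert (HM : Rabs Mp <= INR Q * tau / INR P).
  { unfold Mp, G, X. rewrite blow_up_sum. unfold Rdiv. rewrite Rabs_mult, Rabs_inv, Rabs_mult.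
    rewrite (Rabs_right (INR Q)), (Rabs_right (INR p)) by lra.
    pose proof (Rabs_pos (rsum l w)).
    apply Rmult_le_compat; [apply Rmult_le_pos; lra|left; apply Rinv_0_lt_compat; lra| |].
    - apply Rmult_le_compat_l; lra.
    - apply Rinv_le_contravar; lra. }
  apply Rle_trans with (rsum B (fun i => (ap_sum G p K (b0 + i) - Mp) ^ 2)).
  - fold B. rewrite <- rsum_const. apply rsum_le; intros i Hi.
    assert (C : Rabs (rsum n (fun t => w (nfloor (y t))))
      <= 2 * rsum n (fun t => ind (near_int s (y t))) + 1 + Rabs (ap_sum G p K (b0 + i))).
    { apply block_compare; try assumption; [|lra].
      (* Error budget: s/4 from the curvature and s/2 from rounding, since (W K + 1 + K W) / Q <= 2
         K (W + 1) / Q. *)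
      intros t Ht. specialize (Hlin t Ht).
      assert (Hbi : Rabs (INR (b0 + i) - y 0%nat * INR Q) <= INR B + 1).
      { assert (L1 : INR (nfloor (y 0%nat * INR Q)) <= INR (b0 + i) + INR B)
          by (rewrite <- plus_INR; apply le_INR; lia).
        assert (L2 : INR (b0 + i) <= INR (nfloor (y 0%nat * INR Q)) + INR B)
          by (rewrite <- plus_INR; apply le_INR; lia).
        apply Rabs_le. lra. }
      assert (HtK : INR t <= INR K) by (apply le_INR; lia).
      pose proof (pos_INR t) as Ht0.
      assert (K1 : k' * INR t ^ 2 <= s / 4).
      { eapply Rle_trans; [|exact HkK]. apply Rmult_le_compat_l; [assumption|].
        apply pow_incr; lra. }
      assert (K2 : Rabs (INR t * (INR p - al * INR Q)) <= INR K * INR W).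
      { rewrite Rabs_right by (apply Rle_ge, Rmult_le_pos; lra).
        apply Rmult_le_compat; lra. }
      assert (K3 : 1 <= INR K) by (apply (le_INR 1); lia).
      replace (INR (b0 + i + p * t) / INR Q)
        with (y 0%nat + al * INR t + ((INR (b0 + i) - y 0%nat * INR Q)
               + INR t * (INR p - al * INR Q)) / INR Q)
        by (rewrite (plus_INR (b0 + i)), mult_INR; field; lra).
      set (e := (INR (b0 + i) - y 0%nat * INR Q) + INR t * (INR p - al * INR Q)).
      assert (He : Rabs e <= s / 2 * INR Q).
      { eapply Rle_trans; [apply Rabs_triang|]. unfold B in Hbi. rewrite mult_INR in Hbi. lra. }
      assert (He' : Rabs (e / INR Q) <= s / 2).
      { unfold Rdiv at 1. rewrite Rabs_mult, Rabs_inv, (Rabs_right (INR Q)) by lra.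
        apply Rmult_le_reg_r with (INR Q); [lra|].
        rewrite Rmult_assoc, Rinv_l by lra. lra. }
      apply Rabs_le_inv in He'. apply Rabs_def1; lra. }
    assert (Hz : 0 <= z <= Rabs (ap_sum G p K (b0 + i) - Mp)).
    { split; [apply Rmax_l|]. unfold z. apply Rmax_lub; [apply Rabs_pos|].
      pose proof (Rabs_triang (ap_sum G p K (b0 + i) - Mp) Mp) as T.
      replace (ap_sum G p K (b0 + i) - Mp + Mp) with (ap_sum G p K (b0 + i)) in T by ring.
      lra. }
    rewrite <- (pow2_abs (ap_sum G p K (b0 + i) - Mp)). apply pow_incr; lra.
  - set (g := fun b => (ap_sum G p K b - Mp) ^ 2).
    change (rsum B (fun i => g (b0 + i)%nat) <= rsum p g).
    apply Rle_trans with (rsum (b0 + B) g).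
    + rewrite rsum_app. pose proof (rsum_nonneg b0 g (fun i _ => pow2_ge_0 _)). lra.
    + apply rsum_le_widen; [unfold p; lia|]. intros; apply pow2_ge_0.
Qed.

(** * Summation over consecutive blocks *)

Lemma quadratic_approx (g : nat -> R) (n : nat) (k' : R) :
  (forall i, (i < n)%nat -> 0 <= g (S (S i)) - 2 * g (S i) + g i <= k') ->
  forall t, (t <= n)%nat -> 0 <= g t - g 0%nat - (g 1%nat - g 0%nat) * INR t <= k' * INR t ^ 2.
Proof.
  intros H. induction t as [|t IH]; intros Ht.
  - simpl. lra.
  - specialize (IH ltac:(lia)).
    pose proof (telescope_bounds (fun i => g (S i) - g i) n 0 t 0 k') as T. cbv beta in T.
    rewrite Nat.add_0_l in T.
    assert (T' : INR t * 0 <= g (S t) - g t - (g 1%nat - g 0%nat) <= INR t * k').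
    { apply T; [|lia]. intros i Hi. specialize (H i Hi). lra. }
    assert (0 <= k') by (specialize (H 0%nat ltac:(lia)); lra).
    pose proof (pos_INR t). rewrite S_INR.
    assert (0 <= k' * INR t) by (apply Rmult_le_pos; lra).
    replace (k' * (INR t + 1) ^ 2) with (k' * INR t ^ 2 + (k' * INR t + k' * INR t) + k') by ring.
    lra.
Qed.

Lemma rsum_between (a b : nat) (g : nat -> R) :
  (a <= b)%nat -> rsum (b - a) (fun t => g (a + t)%nat) = rsum b g - rsum a g.
Proof.
  intros H. replace b with (a + (b - a))%nat at 2 by lia. rewrite rsum_app. ring.
Qed.

Lemma rsum_telescope (n : nat) (H : nat -> R) : rsum n (fun i => H (S i) - H i) = H n - H 0%nat.
Proof. induction n as [|n IH]; simpl; [ring|]. rewrite IH. ring. Qed.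

(** All [m] residues and both block lengths are added up, so that one quantity depending only on [p]
    majorises the variance of whichever word a block carries. *)
Definition block_variances (m l Q K p : nat) : R :=
  rsum m (fun a =>
    ap_variance (fib l * Q) (blow_up Q (fib l) (psi m a)) p K
    + ap_variance (fib (l - 1) * Q) (blow_up Q (fib (l - 1)) (psi m a)) p K).

Lemma ap_variance_nonneg (X : nat) (W : nat -> R) (p K : nat) : 0 <= ap_variance X W p K.
Proof. apply rsum_nonneg; intros; apply pow2_ge_0. Qed.

Lemma ap_variance_le_block (m l Q K p a : nat) (b : bool) : (a < m)%nat ->
  ap_variance (block_len l b * Q) (blow_up Q (block_len l b) (psi m a)) p K
  <= block_variances m l Q K p.
Proof.
  intros Ha. unfold block_variances.
  eapply Rle_trans; [|apply (rsum_term_le m a)]; [|assumption|].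
  - pose proof (ap_variance_nonneg (fib l * Q) (blow_up Q (fib l) (psi m a)) p K).
    pose proof (ap_variance_nonneg (fib (l - 1) * Q) (blow_up Q (fib (l - 1)) (psi m a)) p K).
    destruct b; simpl; lra.
  - intros j _.
    pose proof (ap_variance_nonneg (fib l * Q) (blow_up Q (fib l) (psi m j)) p K).
    pose proof (ap_variance_nonneg (fib (l - 1) * Q) (blow_up Q (fib (l - 1)) (psi m j)) p K).
    lra.
Qed.

Lemma block_variances_nonneg (m l Q K p : nat) : 0 <= block_variances m l Q K p.
Proof.
  apply rsum_nonneg; intros. apply Rplus_le_le_0_compat; apply ap_variance_nonneg.
Qed.

Lemma block_variances_sum (m l Q K P : nat) :
  (1 <= m)%nat -> (1 <= Q)%nat -> (1 <= P)%nat -> (fib l * Q <= P * K)%nat -> (K <= 2 * P)%nat ->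
  (K * K <= Q)%nat ->
  rsum P (fun j => block_variances m l Q K (P + j))
  <= INR m * (2 * (INR P * INR (fib l) * INR Q * (7 + 2 * harm K))).
Proof.
  intros Hm HQ HP HX HK HKQ. unfold block_variances. rewrite rsum_swap, <- rsum_const.
  apply rsum_le; intros a _. rewrite rsum_plus.
  assert (L : (fib (l - 1) <= fib l)%nat) by (apply fib_mono; lia).
  pose proof (blow_up_variance_sum Q (fib l) P K (psi m a)) as H1.
  pose proof (blow_up_variance_sum Q (fib (l - 1)) P K (psi m a)) as H2.
  assert (Hpsi : forall u, Rabs (psi m a u) <= 1) by (intros; apply psi_abs; assumption).
  specialize (H1 HQ HP HX HK HKQ Hpsi). specialize (H2 HQ HP ltac:(nia) HK HKQ Hpsi).
  assert (H3 : 0 <= harm K).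
  { apply rsum_nonneg; intros. left. apply Rinv_0_lt_compat, lt_0_INR; lia. }
  assert (H4 : INR P * INR (fib (l - 1)) * INR Q * (7 + 2 * harm K)
     <= INR P * INR (fib l) * INR Q * (7 + 2 * harm K)).
  { apply Rmult_le_compat_r; [lra|]. apply Rmult_le_compat_r; [apply pos_INR|].
    apply Rmult_le_compat_l; [apply pos_INR|]. apply le_INR; assumption. }
  lra.
Qed.

(** Block i uses the [W] moduli just above its slope times Q. Convexity makes the slopes increase,
    so a given modulus serves at most mu + 1 blocks, and all blocks together cost mu + 1 times the
    variance over [P, 2P). Cauchy-Schwarz passes from the sum of squares to [z]. *)
Lemma blocks_bound (m l N M I K Q W P a : nat) (f : nat -> R) (v sh nn : nat -> nat)
  (ty : nat -> bool) (A A' k k' s tau mu : R) :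
  (1 <= m)%nat -> (1 <= Q)%nat -> (1 <= P)%nat -> (1 <= W)%nat ->
  0 < A -> 0 < k -> 0 < s -> 0 <= mu -> 0 <= f N ->
  (forall n, (N <= n <= M)%nat -> A <= f (S n) - f n <= A') ->
  (forall n, (N <= n <= M)%nat -> k <= f (S (S n)) - 2 * f (S n) + f n <= k') ->
  (forall i, (i < I)%nat -> v (S i) = (v i + block_len l (ty i))%nat /\
      forall u, (u < block_len l (ty i))%nat -> sZ (v i + u) = (sh i + sZ u)%nat) ->
  f N <= INR (v 0%nat) ->
  (forall i, (i <= I)%nat -> (N <= nn i <= M)%nat /\ INR (v i) <= f (nn i) /\
      forall n, (N <= n < nn i)%nat -> f n < INR (v i)) ->
  (forall a b, Rabs (rsum (block_len l b) (psi m a)) <= tau) ->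
  INR (fib l) + 2 * A <= INR K * A ->
  INR K * (INR W + 1) <= s * INR Q / 4 -> k' * INR K ^ 2 <= s / 4 ->
  (W * K <= P)%nat -> INR P <= A * INR Q -> s * INR Q <= INR P ->
  A' * INR Q + 1 + INR W <= 2 * INR P ->
  (fib l * Q <= P * K)%nat -> (K <= 2 * P)%nat -> (K * K <= Q)%nat ->
  A' * (INR W / (INR Q * k) + 1) <= mu * INR (fib (l - 1)) ->
  exists z : R, 0 <= z /\
    Rabs (rsum (nn I - nn 0%nat) (fun t => psi m a (nfloor (f (nn 0%nat + t)%nat))))
    <= 2 * rsum (M - N) (fun n => ind (near_int s (f (N + n)%nat)))
       + INR I * (1 + INR Q * tau / INR P) + z /\
    INR W * (INR (W * K) * z ^ 2)
    <= INR I * ((mu + 1) * (INR m * (2 * (INR P * INR (fib l) * INR Q * (7 + 2 * harm K))))).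
Proof.
  intros Hm HQ HP HW HA Hk Hs Hmu HfN HD HD2 Hbl Hv0 Hnn Htau HK HKW HkK HWP HPA HsP HA'P HX HKP HKQ Hmult.
  assert (HQ' : 1 <= INR Q) by (apply (le_INR 1); lia).
  assert (HP' : 1 <= INR P) by (apply (le_INR 1); lia).
  assert (HW' : 1 <= INR W) by (apply (le_INR 1); lia).
  assert (Hinc : forall n d, (N <= n)%nat -> (n + d <= S M)%nat ->
            INR d * A <= f (n + d)%nat - f n <= INR d * A').
  { intros n d Hn Hd.
    pose proof (telescope_bounds (fun t => f (n + t)%nat) d 0 d A A') as T.
    cbv beta in T. rewrite Nat.add_0_l, Nat.add_0_r in T. apply T; [|lia].
    intros t Ht. rewrite Nat.add_succ_r. apply HD; lia. }
  assert (Hf0 : forall n, (N <= n <= S M)%nat -> 0 <= f n).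
  { intros n Hn. destruct (Hinc N (n - N)%nat ltac:(lia) ltac:(lia)) as [H _].
    replace (N + (n - N))%nat with n in H by lia.
    assert (0 <= INR (n - N) * A) by (apply Rmult_le_pos; [apply pos_INR|lra]). lra. }
  assert (Hvm : forall d i, (i + d <= I)%nat -> (v i + d * fib (l - 1) <= v (i + d))%nat).
  { induction d as [|d IH]; intros i Hi; [rewrite (Nat.add_0_r i); lia|].
    specialize (IH i ltac:(lia)). destruct (Hbl (i + d)%nat ltac:(lia)) as [H _].
    rewrite Nat.add_succ_r. pose proof (fib_mono (l - 1) l ltac:(lia)).
    unfold block_len in H. destruct (ty (i + d)%nat); lia. }
  assert (Hnm : forall i, (i < I)%nat -> (nn i <= nn (S i))%nat).
  { intros i Hi. destruct (le_lt_dec (nn i) (nn (S i))) as [L|L]; [assumption|exfalso].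
    destruct (Hnn i ltac:(lia)) as (H1 & H2 & H3).
    destruct (Hnn (S i) ltac:(lia)) as (H4 & H5 & H6).
    specialize (H3 (nn (S i)) ltac:(lia)).
    pose proof (Hvm 1%nat i ltac:(lia)) as H7. rewrite Nat.add_1_r in H7.
    assert (INR (v i) <= INR (v (S i))) by (apply le_INR; lia). lra. }
  assert (Hnm' : forall d i, (i + d <= I)%nat -> (nn i <= nn (i + d))%nat).
  { induction d as [|d IH]; intros i Hi; [rewrite Nat.add_0_r; lia|].
    specialize (IH i ltac:(lia)). specialize (Hnm (i + d)%nat ltac:(lia)).
    rewrite Nat.add_succ_r. lia. }
  assert (Hover : forall i, (i <= I)%nat -> f (nn i) < INR (v i) + A').
  { intros i Hi. destruct (Hnn i Hi) as (H1 & H2 & H3).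
    pose proof (HD N ltac:(lia)) as H4.
    destruct (Nat.eq_dec (nn i) N) as [E|E].
    - rewrite E. pose proof (Hvm i 0%nat ltac:(lia)) as H7. rewrite Nat.add_0_l in H7.
      assert (INR (v 0%nat) <= INR (v i)) by (apply le_INR; lia). lra.
    - specialize (H3 (nn i - 1)%nat ltac:(lia)). specialize (HD (nn i - 1)%nat ltac:(lia)).
      replace (S (nn i - 1)) with (nn i) in HD by lia. lra. }
  set (al := fun i => f (S (nn i)) - f (nn i)).
  assert (Hal : forall i, (i <= I)%nat -> A <= al i <= A').
  { intros i Hi. apply HD. apply Hnn; assumption. }
  (* The value before [nn i] lies below v i, so the overshoot is at most the preceding increment,
     which by convexity is at most the next one. *)
  assert (Hal0 : forall i, (i <= I)%nat -> f (nn i) - INR (v i) <= al i).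
  { intros i Hi. destruct (Hnn i Hi) as (H1 & H2 & H3). specialize (Hal i Hi).
    destruct (Nat.eq_dec (nn i) N) as [E|E].
    - rewrite E. pose proof (Hvm i 0%nat ltac:(lia)) as H7. rewrite Nat.add_0_l in H7.
      assert (INR (v 0%nat) <= INR (v i)) by (apply le_INR; lia). lra.
    - specialize (H3 (nn i - 1)%nat ltac:(lia)). specialize (HD2 (nn i - 1)%nat ltac:(lia)).
      replace (S (nn i - 1)) with (nn i) in HD2 by lia. unfold al. lra. }
  set (g := fun n => psi m a (nfloor (f n))).
  set (nr := fun n => ind (near_int s (f n))).
  set (T := fun i => (nn (S i) - nn i)%nat).
  set (c := INR Q * tau / INR P).
  set (E := fun i => rsum (T i) (fun t => g (nn i + t)%nat)).
  set (bad := fun i => rsum (T i) (fun t => nr (nn i + t)%nat)).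
  set (Z := fun i => Rmax 0 (Rabs (E i) - 2 * bad i - 1 - c)).
  set (p0 := fun i => S (nfloor (al i * INR Q))).
  assert (HZ : forall i, (i < I)%nat -> INR W * (INR (W * K) * Z i ^ 2)
     <= rsum W (fun j => block_variances m l Q K (p0 i + j))).
  { intros i Hi.
    destruct (Hnn i ltac:(lia)) as (N1 & N2 & N3).
    destruct (Hnn (S i) ltac:(lia)) as (N4 & N5 & N6).
    specialize (Hnm i Hi). destruct (Hbl i Hi) as [B1 B2].
    set (len := block_len l (ty i)) in *.
    (* The leading digits of the block shift [a]; reducing mod [m] makes the result one of the
       residues in [block_variances]. *)
    set (a' := ((a + sh i) mod m)%nat).
    set (y := fun t => f (nn i + t)%nat - INR (v i)).
    assert (Hlen : INR len <= INR (fib l)).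
    { apply le_INR. unfold len, block_len. pose proof (fib_mono (l - 1) l ltac:(lia)).
      destruct (ty i); lia. }
    assert (Y0 : forall t, (t <= T i)%nat -> 0 <= y t).
    { intros t Ht. unfold T in Ht.
      destruct (Hinc (nn i) t ltac:(lia) ltac:(lia)) as [H _].
      assert (0 <= INR t * A) by (apply Rmult_le_pos; [apply pos_INR|lra]). unfold y. lra. }
    assert (Y1 : forall t, (t < T i)%nat -> y t < INR len).
    { intros t Ht. unfold T in Ht. specialize (N6 (nn i + t)%nat ltac:(lia)).
      rewrite B1, plus_INR in N6. unfold y. lra. }
    assert (TK : (T i + 1 <= K)%nat).
    { destruct (Nat.eq_dec (T i) 0) as [E0|E0].
      - rewrite E0. destruct K; [simpl in HK; pose proof (pos_INR (fib l)); lra|lia].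
      - specialize (Y1 (T i - 1)%nat ltac:(lia)). unfold y in Y1.
        destruct (Hinc (nn i) (T i - 1)%nat ltac:(lia) ltac:(unfold T; lia)) as [H _].
        rewrite minus_INR in H by lia. simpl (INR 1) in H.
        apply INR_le. rewrite plus_INR. simpl (INR 1).
        apply Rmult_le_reg_r with A; [assumption|]. lra. }
    assert (Eg : forall t, (t < T i)%nat -> g (nn i + t)%nat = psi m a' (nfloor (y t))).
    { intros t Ht. unfold g, a'. rewrite psi_mod by assumption.
      apply psi_shift.
      replace (f (nn i + t)%nat) with (y t + INR (v i)) by (unfold y; ring).
      rewrite nfloor_add_INR by (apply Y0; lia). apply B2.
      apply INR_lt. specialize (Y1 t Ht).
      pose proof (nfloor_bounds (y t) (Y0 t ltac:(lia))). lra. }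
    assert (En : forall t, nr (nn i + t)%nat = ind (near_int s (y t))).
    { intros t. unfold nr.
      replace (f (nn i + t)%nat) with (y t + INR (v i)) by (unfold y; ring).
      rewrite near_int_add_INR. reflexivity. }
    assert (Ez : Z i = Rmax 0 (Rabs (rsum (T i) (fun t => psi m a' (nfloor (y t))))
      - 2 * rsum (T i) (fun t => ind (near_int s (y t))) - 1 - c)).
    { unfold Z, E, bad. rewrite (rsum_ext (T i) _ _ Eg).
      rewrite (rsum_ext (T i) (fun t => nr (nn i + t)%nat) _ (fun t _ => En t)). reflexivity. }
    rewrite Ez. eapply Rle_trans.
    - apply (block_variance y (psi m a') len Q (T i) K W P (al i) k' s tau); try assumption.
      + intros; apply psi_abs; assumption.
      + unfold y, T. replace (nn i + (nn (S i) - nn i))%nat with (nn (S i)) by lia.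
        rewrite B1, plus_INR in N5. lra.
      + intros t Ht.
        pose proof (quadratic_approx y (T i) k') as H. unfold al.
        replace (f (S (nn i)) - f (nn i)) with (y 1%nat - y 0%nat)
          by (unfold y; rewrite Nat.add_0_r, Nat.add_1_r; ring).
        apply H; [|assumption]. intros j Hj. unfold T in Hj.
        specialize (HD2 (nn i + j)%nat ltac:(lia)).
        unfold y. rewrite !Nat.add_succ_r. lra.
      + specialize (HD2 N ltac:(lia)). lra.
      + unfold y. rewrite Nat.add_0_r. apply Hal0; lia.
      + specialize (Hal i ltac:(lia)).
        assert (A * INR Q <= al i * INR Q) by (apply Rmult_le_compat_r; lra). lra.
      + apply Htau.
    - apply rsum_le; intros j _. apply ap_variance_le_block.
      apply Nat.mod_upper_bound; lia. }
  assert (Hp0 : forall i, (i <= I)%nat -> al i * INR Q < INR (p0 i) <= al i * INR Q + 1 /\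
              (P <= p0 i)%nat /\ (p0 i - P + W <= P)%nat).
  { intros i Hi. specialize (Hal i Hi).
    assert (L1 : A * INR Q <= al i * INR Q) by (apply Rmult_le_compat_r; lra).
    assert (L2 : al i * INR Q <= A' * INR Q) by (apply Rmult_le_compat_r; lra).
    assert (L3 : 0 <= al i * INR Q) by (apply Rmult_le_pos; lra).
    pose proof (nfloor_bounds _ L3) as L4.
    assert (L5 : al i * INR Q < INR (p0 i) <= al i * INR Q + 1) by (unfold p0; rewrite S_INR; lra).
    assert (L6 : (P <= p0 i)%nat) by (apply INR_le; lra).
    split; [assumption|split; [assumption|]].
    apply INR_le. rewrite plus_INR, minus_INR by assumption. lra. }
  assert (HZZ : INR W * (INR (W * K) * rsum I (fun i => Z i ^ 2))
     <= (mu + 1) * (INR m * (2 * (INR P * INR (fib l) * INR Q * (7 + 2 * harm K))))).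
  (* Writing the windows of moduli as indicators on [P, 2P) allows the exchange of the sums over
     blocks and moduli. *)
  { apply Rle_trans with (rsum I (fun i => rsum P (fun j =>
       ind ((p0 i - P <=? j) && (j <? p0 i - P + W))%nat * block_variances m l Q K (P + j)))).
    - rewrite <- !rsum_scal. apply rsum_le; intros i Hi.
      destruct (Hp0 i ltac:(lia)) as (_ & L2 & L3).
      rewrite rsum_ind_range by assumption. eapply Rle_trans; [apply HZ; assumption|].
      right. apply rsum_ext; intros j _. f_equal. lia.
    - rewrite rsum_swap.
      apply Rle_trans with (rsum P (fun j => (mu + 1) * block_variances m l Q K (P + j))).
      + apply rsum_le; intros j Hj.
        rewrite (rsum_ext I _ (fun i => block_variances m l Q K (P + j)
            * ind ((p0 i - P <=? j) && (j <? p0 i - P + W))%nat)) by (intros; ring).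
        rewrite rsum_scal, Rmult_comm. apply Rmult_le_compat_r; [apply block_variances_nonneg|].
        (* If blocks i < h share a modulus, their slopes differ by at most W / Q, hence their
           starting times by at most W / (Q k), hence their starting values by less than mu fib
           (l-1). Each block is at least fib (l-1) long, so h - i < mu. *)
        apply (count_close I (fun i => (p0 i - P <=? j) && (j <? p0 i - P + W))%nat); [assumption|].
        intros i h Hih Qi Qh.
        apply andb_true_iff in Qi, Qh. destruct Qi as [_ Qi]. destruct Qh as [Qh _].
        apply Nat.ltb_lt in Qi. apply Nat.leb_le in Qh.
        destruct (Hp0 i ltac:(lia)) as (I1 & I2 & I3).
        destruct (Hp0 h ltac:(lia)) as (J1 & J2 & J3).
        assert (P1 : INR (p0 h) + 1 <= INR (p0 i) + INR W)
          by (rewrite <- S_INR, <- plus_INR; apply le_INR; lia).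
        assert (P2 : (al h - al i) * INR Q <= INR W) by lra.
        pose proof (Hnm' (h - i)%nat i ltac:(lia)) as Hn.
        replace (i + (h - i))%nat with h in Hn by lia.
        destruct (Hnn i ltac:(lia)) as (N1 & N2 & N3).
        destruct (Hnn h ltac:(lia)) as (N4 & N5 & N6).
        set (dn := (nn h - nn i)%nat).
        assert (P3 : INR dn * k <= al h - al i).
        { pose proof (telescope_bounds (fun t => f (S (nn i + t)) - f (nn i + t)%nat) dn 0 dn k k') as T0.
          cbv beta in T0. rewrite Nat.add_0_l, Nat.add_0_r in T0.
          replace (nn i + dn)%nat with (nn h) in T0 by (unfold dn; lia).
          unfold al. apply T0; [|lia]. intros t Ht. unfold dn in Ht.
          specialize (HD2 (nn i + t)%nat ltac:(lia)). rewrite Nat.add_succ_r. lra. }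
        assert (P4 : INR dn <= INR W / (INR Q * k)).
        { apply Rmult_le_reg_r with (INR Q * k); [apply Rmult_lt_0_compat; lra|].
          replace (INR W / (INR Q * k) * (INR Q * k)) with (INR W) by (field; lra).
          eapply Rle_trans; [|exact P2].
          replace (INR dn * (INR Q * k)) with (INR dn * k * INR Q) by ring.
          apply Rmult_le_compat_r; lra. }
        destruct (Hinc (nn i) dn ltac:(lia) ltac:(unfold dn; lia)) as [_ P5].
        replace (nn i + dn)%nat with (nn h) in P5 by (unfold dn; lia).
        specialize (Hover i ltac:(lia)).
        pose proof (Hvm (h - i)%nat i ltac:(lia)) as P6.
        replace (i + (h - i))%nat with h in P6 by lia.
        apply le_INR in P6. rewrite plus_INR, mult_INR, minus_INR in P6 by lia.
        assert (P7 : A' * INR dn <= A' * (INR W / (INR Q * k))).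
        { apply Rmult_le_compat_l; [|assumption]. specialize (Hal i ltac:(lia)). lra. }
        assert (P8 : (INR h - INR i) * INR (fib (l - 1)) < mu * INR (fib (l - 1))) by lra.
        left. apply Rmult_lt_reg_r with (INR (fib (l - 1))); [|assumption].
        destruct (pos_INR (fib (l - 1))) as [G|G]; [assumption|].
        rewrite <- G in P8. lra.
      + rewrite rsum_scal. apply Rmult_le_compat_l; [lra|].
        apply block_variances_sum; assumption. }
  assert (HZ0 : forall i, 0 <= Z i) by (intros; apply Rmax_l).
  exists (rsum I Z). split; [apply rsum_nonneg; auto|]. split.
  - assert (E1 : rsum (nn I - nn 0%nat) (fun t => g (nn 0%nat + t)%nat) = rsum I E).
    { rewrite (rsum_ext I E (fun i => rsum (nn (S i)) g - rsum (nn i) g)).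
      - rewrite (rsum_telescope I (fun i => rsum (nn i) g)). apply rsum_between.
        apply (Hnm' I 0%nat); lia.
      - intros i Hi. apply rsum_between. apply Hnm; assumption. }
    assert (E2 : rsum I bad <= rsum (M - N) (fun n => nr (N + n)%nat)).
    { destruct (Hnn 0%nat ltac:(lia)) as ((L1 & L1') & _).
      destruct (Hnn I ltac:(lia)) as ((L2 & L2') & _).
      rewrite (rsum_ext I bad (fun i => rsum (nn (S i)) nr - rsum (nn i) nr)).
      - rewrite (rsum_telescope I (fun i => rsum (nn i) nr)).
        rewrite rsum_between by lia.
        assert (rsum N nr <= rsum (nn 0%nat) nr)
          by (apply rsum_le_widen; [assumption|intros; apply ind_bounds]).
        assert (rsum (nn I) nr <= rsum M nr)
          by (apply rsum_le_widen; [assumption|intros; apply ind_bounds]).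
        lra.
      - intros i Hi. apply rsum_between. apply Hnm; assumption. }
    change (Rabs (rsum (nn I - nn 0%nat) (fun t => g (nn 0%nat + t)%nat))
      <= 2 * rsum (M - N) (fun n => nr (N + n)%nat) + INR I * (1 + c) + rsum I Z).
    rewrite E1. eapply Rle_trans; [apply rsum_abs|].
    apply Rle_trans with (rsum I (fun i => 2 * bad i + (1 + c) + Z i)).
    + apply rsum_le; intros i _.
      pose proof (Rmax_r 0 (Rabs (E i) - 2 * bad i - 1 - c)) as H. fold (Z i) in H. lra.
    + rewrite rsum_plus, rsum_plus, rsum_scal, rsum_const. lra.
  - eapply Rle_trans; [|apply Rmult_le_compat_l; [apply pos_INR|exact HZZ]].
    pose proof (cauchy_schwarz I Z) as CS.
    apply Rle_trans with (INR W * (INR (W * K) * (INR I * rsum I (fun i => Z i ^ 2)))).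
    + apply Rmult_le_compat_l; [lra|]. apply Rmult_le_compat_l; [apply pos_INR|exact CS].
    + right. ring.
Qed.

Fixpoint first_ge (g : nat -> R) (y : R) (n k : nat) : nat :=
  match k with
  | O => n
  | S k' => if Rle_dec y (g n) then n else first_ge g y (S n) k'
  end.

Lemma first_ge_spec (g : nat -> R) (y : R) (k n : nat) : y <= g (n + k)%nat ->
  (n <= first_ge g y n k <= n + k)%nat /\ y <= g (first_ge g y n k) /\
  forall j, (n <= j < first_ge g y n k)%nat -> g j < y.
Proof.
  revert n. induction k as [|k IH]; intros n H; cbn [first_ge].
  - rewrite Nat.add_0_r in H. split; [lia|split; [assumption|]]. intros; lia.
  - destruct (Rle_dec y (g n)) as [L|L].
    + split; [lia|split; [assumption|]]. intros; lia.
    + destruct (IH (S n)) as (H1 & H2 & H3).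
      { replace (S n + k)%nat with (n + S k)%nat by lia. assumption. }
      split; [lia|split; [assumption|]]. intros j Hj.
      destruct (Nat.eq_dec j n) as [->|Hne]; [lra|]. apply H3; lia.
Qed.

Lemma psi_range_trivial (m a n : nat) (h : nat -> nat) : (1 <= m)%nat ->
  Rabs (rsum n (fun t => psi m a (h t))) <= INR n.
Proof.
  intros Hm. eapply Rle_trans; [apply rsum_abs|].
  rewrite <- (Rmult_1_r (INR n)), <- rsum_const.
  apply rsum_le; intros; apply psi_abs; assumption.
Qed.

(** The incomplete blocks at the two ends contain at most [K] values of [n] each and are estimated
    trivially, whence 2 K. *)
Lemma interval_bound (m l N M K Q W P a : nat) (f : nat -> R) (A A' k k' s tau mu : R) :
  (1 <= m)%nat -> (3 <= l)%nat -> (1 <= Q)%nat -> (1 <= P)%nat -> (1 <= W)%nat -> (N <= M)%nat ->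
  0 < A -> 0 < k -> 0 < s -> 0 <= mu -> 0 < f N ->
  (forall n, (N <= n <= M)%nat -> A <= f (S n) - f n <= A') ->
  (forall n, (N <= n <= M)%nat -> k <= f (S (S n)) - 2 * f (S n) + f n <= k') ->
  (forall a b, Rabs (rsum (block_len l b) (psi m a)) <= tau) ->
  INR (fib l) + 2 * A <= INR K * A ->
  INR K * (INR W + 1) <= s * INR Q / 4 -> k' * INR K ^ 2 <= s / 4 ->
  (W * K <= P)%nat -> INR P <= A * INR Q -> s * INR Q <= INR P ->
  A' * INR Q + 1 + INR W <= 2 * INR P ->
  (fib l * Q <= P * K)%nat -> (K <= 2 * P)%nat -> (K * K <= Q)%nat ->
  A' * (INR W / (INR Q * k) + 1) <= mu * INR (fib (l - 1)) ->
  exists (I : nat) (z : R), 0 <= z /\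
    INR I * INR (fib (l - 1)) <= f M - f N /\
    Rabs (rsum (M - N) (fun t => psi m a (nfloor (f (N + t)%nat))))
    <= 2 * rsum (M - N) (fun n => ind (near_int s (f (N + n)%nat)))
       + INR I * (1 + INR Q * tau / INR P) + z + 2 * INR K /\
    INR W * (INR (W * K) * z ^ 2)
    <= INR I * ((mu + 1) * (INR m * (2 * (INR P * INR (fib l) * INR Q * (7 + 2 * harm K))))).
Proof.
  intros Hm Hl HQ HP HW HNM HA Hk Hs Hmu HfN HD HD2 Htau HK HKW HkK HWP HPA HsP HA'P HX HKP HKQ Hmult.
  assert (Hinc : forall n d, (N <= n)%nat -> (n + d <= S M)%nat ->
            INR d * A <= f (n + d)%nat - f n <= INR d * A').
  { intros n d Hn Hd.
    pose proof (telescope_bounds (fun t => f (n + t)%nat) d 0 d A A') as T.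
    cbv beta in T. rewrite Nat.add_0_l, Nat.add_0_r in T. apply T; [|lia].
    intros t Ht. rewrite Nat.add_succ_r. apply HD; lia. }
  assert (Hmono : forall n n', (N <= n <= n')%nat -> (n' <= S M)%nat -> f n <= f n').
  { intros n n' H1 H2. destruct (Hinc n (n' - n)%nat ltac:(lia) ltac:(lia)) as [H _].
    replace (n + (n' - n))%nat with n' in H by lia.
    assert (0 <= INR (n' - n) * A) by (apply Rmult_le_pos; [apply pos_INR|lra]). lra. }
  assert (HfM : 0 < f M) by (pose proof (Hmono N M ltac:(lia) ltac:(lia)); lra).
  set (g := fun n => psi m a (nfloor (f n))).
  assert (Hg : forall b n, Rabs (rsum n (fun t => g (b + t)%nat)) <= INR n)
    by (intros; apply psi_range_trivial; assumption).
  (* The level is large enough, by [fib_ge_pred], for the last boundary to exceed f M. *)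
  destruct (zeckendorf_blocks l (nfloor (f M) + 2) Hl) as (I0 & v & sh & ty & V0 & VI & HB).
  assert (HvI : f M <= INR (v I0)).
  { rewrite VI. pose proof (nfloor_bounds (f M)) as H.
    pose proof (fib_ge_pred (l + (nfloor (f M) + 2))) as H1.
    assert (H2 : (S (nfloor (f M)) <= fib (l + (nfloor (f M) + 2)))%nat) by lia.
    apply le_INR in H2. rewrite S_INR in H2. lra. }
  assert (Hstep : forall i, (i < I0)%nat -> (v i + fib (l - 1) <= v (S i) <= v i + fib l)%nat).
  { intros i Hi. destruct (HB i Hi) as [H _]. pose proof (fib_mono (l - 1) l ltac:(lia)).
    unfold block_len in H. destruct (ty i); lia. }
  assert (Hvm : forall d i, (i + d <= I0)%nat -> (v i + d * fib (l - 1) <= v (i + d))%nat).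
  { induction d as [|d IH]; intros i Hi; [rewrite (Nat.add_0_r i); lia|].
    specialize (IH i ltac:(lia)). specialize (Hstep (i + d)%nat ltac:(lia)).
    rewrite Nat.add_succ_r. lia. }
  destruct (first_ge_spec (fun i => INR (v i)) (f M) I0 0 HvI) as (S1 & S2 & S3).
  set (i2 := first_ge (fun i => INR (v i)) (f M) 0 I0) in *. cbv beta in S2, S3.
  assert (HvI' : f N <= INR (v (0 + i2)%nat)).
  { rewrite Nat.add_0_l. pose proof (Hmono N M ltac:(lia) ltac:(lia)). lra. }
  destruct (first_ge_spec (fun i => INR (v i)) (f N) i2 0 HvI') as (R1 & R2 & R3).
  set (i0 := first_ge (fun i => INR (v i)) (f N) 0 i2) in *. cbv beta in R2, R3.
  destruct i2 as [|i1]; [rewrite V0 in S2; simpl in S2; lra|].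
  pose proof (S3 i1 ltac:(lia)) as S4.
  assert (Step1 : INR (v (S i1)) <= INR (v i1) + INR (fib l))
    by (rewrite <- plus_INR; apply le_INR, Hstep; lia).
  assert (Kbound : forall n n', (N <= n <= n')%nat -> (n' <= S M)%nat ->
            f n' - f n <= INR (fib l) -> INR (n' - n) + 2 <= INR K).
  { intros n n' H1 H2 H3. destruct (Hinc n (n' - n)%nat ltac:(lia) ltac:(lia)) as [H _].
    replace (n + (n' - n))%nat with n' in H by lia.
    apply Rmult_le_reg_r with A; [assumption|]. lra. }
  assert (Bad0 : 0 <= rsum (M - N) (fun n => ind (near_int s (f (N + n)%nat))))
    by (apply rsum_nonneg; intros; apply ind_bounds).
  (* Either boundaries [i0] to [i1] delimit the complete blocks between f N and f M, or no boundary
     separates the two values and the whole range is one short piece. *)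
  destruct (le_lt_dec i0 i1) as [L|L].
  - set (nn := fun i => first_ge f (INR (v (i0 + i)%nat)) N (M - N)).
    set (I := (i1 - i0)%nat).
    assert (Hnn : forall i, (i <= I)%nat -> (N <= nn i <= M)%nat /\
       INR (v (i0 + i)%nat) <= f (nn i) /\
       forall n, (N <= n < nn i)%nat -> f n < INR (v (i0 + i)%nat)).
    { intros i Hi. unfold I in Hi. replace M with (N + (M - N))%nat at 1 by lia.
      apply first_ge_spec. replace (N + (M - N))%nat with M by lia.
      apply Rle_trans with (INR (v i1)); [|lra]. apply le_INR.
      pose proof (Hvm (i1 - (i0 + i))%nat (i0 + i)%nat ltac:(lia)) as H.
      replace (i0 + i + (i1 - (i0 + i)))%nat with i1 in H by lia. lia. }
    destruct (blocks_bound m l N M I K Q W P a f (fun i => v (i0 + i)%nat)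
      (fun i => sh (i0 + i)%nat) nn (fun i => ty (i0 + i)%nat) A A' k k' s tau mu)
      as (z & Z1 & Z2 & Z3); try assumption.
    + lra.
    + intros i Hi. rewrite Nat.add_succ_r. apply HB. unfold I in Hi. lia.
    + rewrite Nat.add_0_r. assumption.
    + exists I, z. split; [assumption|]. split; [|split; [|assumption]].
      * pose proof (Hvm I i0 ltac:(unfold I; lia)) as H.
        replace (i0 + I)%nat with i1 in H by (unfold I; lia).
        apply le_INR in H. rewrite plus_INR, mult_INR in H. lra.
      * destruct (Hnn 0%nat ltac:(lia)) as (A1 & A2 & A3).
        destruct (Hnn I ltac:(lia)) as (B1 & B2 & B3).
        rewrite Nat.add_0_r in A2, A3.
        replace (i0 + I)%nat with i1 in B2, B3 by (unfold I; lia).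
        assert (Hmid : (nn 0%nat <= nn I)%nat).
        { destruct (le_lt_dec (nn 0%nat) (nn I)) as [G|G]; [assumption|exfalso].
          specialize (A3 (nn I) ltac:(lia)).
          pose proof (Hvm I i0 ltac:(unfold I; lia)) as H.
          replace (i0 + I)%nat with i1 in H by (unfold I; lia).
          assert (INR (v i0) <= INR (v i1)) by (apply le_INR; lia). lra. }
        assert (Pre : INR (nn 0%nat - N) <= INR K).
        { destruct (Nat.eq_dec (nn 0%nat) N) as [E|E].
          - rewrite E, Nat.sub_diag. apply pos_INR.
          - specialize (A3 (nn 0%nat - 1)%nat ltac:(lia)).
            assert (INR (v i0) <= f N + INR (fib l)).
            { destruct i0 as [|i0']; [rewrite V0; simpl (INR 0); pose proof (pos_INR (fib l)); lra|].
              specialize (R3 i0' ltac:(lia)).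
              assert (INR (v (S i0')) <= INR (v i0') + INR (fib l))
                by (rewrite <- plus_INR; apply le_INR, Hstep; lia). lra. }
            pose proof (Kbound N (nn 0%nat - 1)%nat ltac:(lia) ltac:(lia) ltac:(lra)) as G.
            rewrite !minus_INR in * by lia. simpl (INR 1) in G. lra. }
        assert (Post : INR (M - nn I) <= INR K).
        { pose proof (Kbound (nn I) M ltac:(lia) ltac:(lia) ltac:(lra)). lra. }
        pose proof (Hg N (nn 0%nat - N)%nat) as G1. rewrite rsum_between in G1 by lia.
        pose proof (Hg (nn I) (M - nn I)%nat) as G2. rewrite rsum_between in G2 by lia.
        change (Rabs (rsum (nn I - nn 0%nat) (fun t => g (nn 0%nat + t)%nat))
          <= 2 * rsum (M - N) (fun n => ind (near_int s (f (N + n)%nat)))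
             + INR I * (1 + INR Q * tau / INR P) + z) in Z2.
        rewrite rsum_between in Z2 by lia.
        change (Rabs (rsum (M - N) (fun t => g (N + t)%nat))
          <= 2 * rsum (M - N) (fun n => ind (near_int s (f (N + n)%nat)))
             + INR I * (1 + INR Q * tau / INR P) + z + 2 * INR K).
        rewrite rsum_between by lia.
        apply Rabs_le_inv in G1. apply Rabs_le_inv in G2. apply Rabs_le_inv in Z2.
        apply Rabs_le. lra.
  - exists 0%nat, 0. split; [lra|]. split; [|split].
    + simpl. pose proof (Hmono N M ltac:(lia) ltac:(lia)). lra.
    + specialize (R3 i1 ltac:(lia)).
      pose proof (Kbound N M ltac:(lia) ltac:(lia) ltac:(lra)) as G.
      pose proof (Hg N (M - N)%nat) as G1.
      change (Rabs (rsum (M - N) (fun t => g (N + t)%nat))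
        <= 2 * rsum (M - N) (fun n => ind (near_int s (f (N + n)%nat)))
           + INR 0 * (1 + INR Q * tau / INR P) + 0 + 2 * INR K).
      simpl (INR 0). pose proof (pos_INR K). lra.
    + simpl. lra.
Qed.

(** * Choice of parameters *)

Lemma fib_bracket (U : R) : 2 <= U ->
  exists l, (3 <= l)%nat /\ INR (fib l) <= U < INR (fib (S l)).
Proof.
  intros HU. pose proof (nfloor_bounds U ltac:(lra)) as HF. set (k := nfloor U) in *.
  destruct (first_ge_spec (fun i => INR (fib i)) (INR (S k)) (k + 2) 0) as (_ & H2 & H3).
  { apply le_INR. rewrite Nat.add_0_l. pose proof (fib_ge_pred (k + 2)). lia. }
  set (i := first_ge (fun i => INR (fib i)) (INR (S k)) 0 (k + 2)) in *.
  cbv beta in H2, H3. rewrite S_INR in H2, H3.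
  assert (Hi : (4 <= i)%nat).
  { destruct (le_lt_dec 4 i) as [L|L]; [assumption|exfalso].
    assert (H : INR (fib i) <= INR (fib 3)) by (apply le_INR, fib_mono; lia).
    simpl in H. lra. }
  exists (i - 1)%nat. split; [lia|]. replace (S (i - 1)) with i by lia.
  split; [|lra]. specialize (H3 (i - 1)%nat ltac:(lia)).
  enough (fib (i - 1) <= k)%nat by (apply le_INR in H; lra).
  apply Nat.lt_succ_r, INR_lt. rewrite S_INR. assumption.
Qed.

Lemma harm_nonneg (n : nat) : 0 <= harm n.
Proof. apply rsum_nonneg; intros. left. apply Rinv_0_lt_compat, lt_0_INR; lia. Qed.

(* [r] is the length, up to constants, on which the quadratic error [k r^2] of the linear
   approximation stays below the tolerance [s]; the blocks are chosen with [F_l] about [A r], and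
   [Q = N^2] makes all rounding errors negligible. *)
Lemma explicit_bound (m N M T a : nat) (f : nat -> R) (A k s r C q : R) :
  (1 <= m)%nat -> (N <= M <= 2 * N)%nat -> (1 <= T)%nat -> (2 * T <= N)%nat ->
  1 <= A -> 0 < k -> 0 < s <= 1 / 4 -> r ^ 2 * k = s -> 24 <= r <= INR N ->
  8 * r <= s * INR N ^ 2 -> 0 < f N ->
  (forall n, (N <= n <= 2 * N)%nat -> A <= f (S n) - f n <= 3 / 2 * A) ->
  (forall n, (N <= n < 3 * N)%nat -> k / 4 <= f (S (S n)) - 2 * f (S n) + f n <= k) ->
  0 < C -> 0 < q < 1 -> (forall a k, Rabs (psi_sum m a k) <= C * q ^ k * INR (fib k)) ->
  exists (l : nat) (z : R), (1 <= l)%nat /\ A * r / 8 <= INR (fib l) /\ 0 <= z /\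
    z ^ 2 <= 83328 * INR m * (INR N * A ^ 2 * r * (7 + 2 * harm N) / s ^ 2) /\
    Rabs (rsum (M - N) (fun t => psi m a (nfloor (f (N + t)%nat))))
    <= 2 * (INR N / INR T + 1 + 2 * INR T * (32 * INR N * s + 2 * INR N * INR T * k
                                            + 192 * r ^ 2 + 3))
       + 24 * (INR N / r) + 12 * C * q ^ (l - 1) * INR N + z + r.
Proof.
  intros Hm HNM HT HTN HA Hk Hs Hr HrN HrQ HfN HD HD2 HC Hq Hpsi.
  set (X := INR N) in *.
  assert (HAr : 24 <= A * r) by nra.
  destruct (fib_bracket (A * r / 4) ltac:(lra)) as (l & Hl & HF1 & HF2).
  set (F := INR (fib l)) in *.
  assert (HF3 : A * r / 8 <= F).
  { pose proof (fib_double l ltac:(lia)) as H. apply le_INR in H. rewrite mult_INR in H.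
    simpl (INR 2) in H. fold F in H. lra. }
  assert (HF4 : A * r / 16 <= INR (fib (l - 1))).
  { pose proof (fib_double (l - 1) ltac:(lia)) as H. replace (S (l - 1)) with l in H by lia.
    apply le_INR in H. rewrite mult_INR in H. simpl (INR 2) in H. fold F in H. lra. }
  assert (HFA : r / 8 <= F / A <= r / 4).
  { split; apply Rmult_le_reg_r with A; try lra; unfold Rdiv at 2;
      rewrite ?Rmult_assoc, ?Rinv_l by lra; [|unfold Rdiv at 1; rewrite Rmult_assoc, Rinv_l by lra];
      lra. }
  pose proof (nfloor_bounds (F / A) ltac:(lra)) as HKb.
  (* The 3 gives F + 2 A <= K A; as r >= 24, still K <= r/2, so that k K^2 <= s/4. *)
  set (K := (nfloor (F / A) + 3)%nat).
  assert (HK : F / A + 2 < INR K <= F / A + 3).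
  { unfold K. rewrite plus_INR. simpl (INR 3). lra. }
  assert (HKr : r / 8 <= INR K <= r / 2) by lra.
  set (Q := (N * N)%nat).
  assert (HQ : INR Q = X ^ 2) by (unfold Q; rewrite mult_INR; fold X; ring).
  assert (HX2 : 24 * 24 <= X ^ 2) by nra.
  assert (HsQ : 16 * INR K <= s * INR Q) by (rewrite HQ; lra).
  assert (HwK : 4 <= s * INR Q / (4 * INR K)).
  { apply Rmult_le_reg_r with (4 * INR K); [lra|].
    unfold Rdiv. rewrite Rmult_assoc, Rinv_l by lra. lra. }
  pose proof (nfloor_bounds (s * INR Q / (4 * INR K)) ltac:(lra)) as HWb.
  set (W0 := nfloor (s * INR Q / (4 * INR K))) in *.
  (* The largest admissible box: subtracting 1 gives K (W + 1) <= s Q / 4, and [W] loses at most a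
     factor 2. *)
  set (W := (W0 - 1)%nat).
  assert (HW0 : (3 <= W0)%nat).
  { apply INR_le. simpl (INR 3). lra. }
  assert (HWi : INR W = INR W0 - 1) by (unfold W; rewrite minus_INR by lia; simpl; ring).
  assert (HWK : INR K * (INR W + 1) <= s * INR Q / 4).
  { rewrite HWi. replace (INR W0 - 1 + 1) with (INR W0) by ring.
    apply Rle_trans with (INR K * (s * INR Q / (4 * INR K))).
    - apply Rmult_le_compat_l; lra.
    - right. field. lra. }
  assert (HWlow : s * INR Q / (8 * INR K) <= INR W).
  { replace (s * INR Q / (8 * INR K)) with (s * INR Q / (4 * INR K) / 2) by (field; lra). lra. }
  assert (HAQ : INR Q <= A * INR Q) by (pose proof (pos_INR Q); nra).
  pose proof (nfloor_bounds (A * INR Q) ltac:(pose proof (pos_INR Q); lra)) as HPb.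
  set (P := nfloor (A * INR Q)) in *.
  assert (HW1 : 1 <= INR W) by (apply (le_INR 1); unfold W; lia).
  assert (HWQ : INR W * INR K <= INR Q / 16) by nra.
  assert (HWQ' : INR W <= INR Q / 16) by nra.
  assert (HP2 : A * INR Q / 2 <= INR P) by lra.
  assert (HKK : (K * K <= Q)%nat).
  { apply INR_le. rewrite mult_INR, HQ. nra. }
  assert (HKQ' : INR K <= INR Q).
  { apply le_INR. assert (1 <= K)%nat by (unfold K; lia). nia. }
  (* The value 216 is 16 (3/2) 9: slopes are at most 3 A / 2, the starting times compared differ by
     at most 8 r, which with the extra 1 is below 9 r, and fib (l-1) >= A r / 16. *)
  destruct (interval_bound m l N M K Q W P a f A (3 / 2 * A) (k / 4) k s
              (C * q ^ (l - 1) * F) 216) as (I & z & Z0 & ZI & ZB & ZZ).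
  - assumption.
  - assumption.
  - apply INR_le. simpl (INR 1). lra.
  - apply INR_le. simpl (INR 1). lra.
  - unfold W; lia.
  - lia.
  - lra.
  - lra.
  - lra.
  - lra.
  - assumption.
  - intros n Hn. apply HD. lia.
  - intros n Hn. apply HD2. assert (24 <= N)%nat by (apply INR_le; simpl; unfold X in *; lra). lia.
  - intros b [|]; unfold block_len; change (rsum (fib ?x) (psi m b)) with (psi_sum m b x).
    + eapply Rle_trans; [apply Hpsi|]. fold F. apply Rmult_le_compat_r; [apply pos_INR|].
      apply Rmult_le_compat_l; [lra|]. replace l with (S (l - 1)) at 1 by lia.
      rewrite <- tech_pow_Rmult. assert (0 < q ^ (l - 1)) by (apply pow_lt; lra). nra.
    + eapply Rle_trans; [apply Hpsi|].
      apply Rmult_le_compat_l.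
      * apply Rmult_le_pos; [lra|]. left. apply pow_lt; lra.
      * apply le_INR, fib_mono; lia.
  - fold F. replace (F + 2 * A) with ((F / A + 2) * A) by (field; lra).
    apply Rmult_le_compat_r; lra.
  - assumption.
  - rewrite <- Hr. assert (INR K ^ 2 <= (r / 2) ^ 2) by (apply pow_incr; lra). nra.
  - apply INR_le. rewrite mult_INR. lra.
  - lra.
  - assert (s * INR Q <= 1 / 4 * INR Q) by (apply Rmult_le_compat_r; lra). lra.
  - lra.
  - apply INR_le. rewrite !mult_INR. fold F.
    apply Rle_trans with ((A * INR Q - 1) * INR K).
    + apply Rle_trans with ((F / A + 2) * A * INR Q - INR K).
      * replace ((F / A + 2) * A * INR Q) with (F * INR Q + 2 * (A * INR Q)) by (field; lra). lra.
      * assert ((F / A + 2) * (A * INR Q) <= INR K * (A * INR Q))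
          by (apply Rmult_le_compat_r; lra). lra.
    + apply Rmult_le_compat_r; lra.
  - apply INR_le. rewrite mult_INR. simpl (INR 2). lra.
  - assumption.
  - assert (E : INR W / (INR Q * (k / 4)) <= 8 * r).
    { apply Rmult_le_reg_r with (INR Q * (k / 4)); [apply Rmult_lt_0_compat; lra|].
      unfold Rdiv at 1. rewrite Rmult_assoc, Rinv_l by (apply Rgt_not_eq, Rmult_lt_0_compat; lra).
      rewrite Rmult_1_r.
      apply Rmult_le_reg_l with (INR K); [lra|].
      apply Rle_trans with (s * INR Q / 4); [lra|]. rewrite <- Hr.
      assert (0 <= INR Q * k * r) by (repeat apply Rmult_le_pos; lra). nra. }
    apply Rle_trans with (3 / 2 * A * (9 * r)); [apply Rmult_le_compat_l; lra|].
    lra.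
  - exists l, z.
    assert (HI : INR I <= 24 * (X / r)).
    { assert (G : f M - f N <= INR (M - N) * (3 / 2 * A)).
      { pose proof (telescope_bounds (fun t => f (N + t)%nat) (M - N) 0 (M - N) A (3 / 2 * A)) as TB.
        cbv beta in TB. rewrite Nat.add_0_l, Nat.add_0_r in TB.
        replace (N + (M - N))%nat with M in TB by lia. apply TB; [|lia].
        intros t Ht. rewrite Nat.add_succ_r. apply HD; lia. }
      assert (G2 : INR (M - N) <= X) by (apply le_INR; lia).
      assert (G3 : INR (M - N) * (3 / 2 * A) <= X * (3 / 2 * A)) by (apply Rmult_le_compat_r; lra).
      assert (G4 : INR I * (A * r / 16) <= INR I * INR (fib (l - 1)))
        by (apply Rmult_le_compat_l; [apply pos_INR|assumption]).
      apply Rmult_le_reg_r with (A * r / 16); [lra|].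
      replace (24 * (X / r) * (A * r / 16)) with (X * (3 / 2 * A)) by (field; lra). lra. }
    assert (HB : rsum (M - N) (fun n => ind (near_int s (f (N + n)%nat)))
      <= X / INR T + 1 + 2 * INR T * (32 * X * s + 2 * X * INR T * k + 192 * r ^ 2 + 3)).
    (* These windows cover the range and overshoot by at most T; with the lags, second differences
       are needed up to M + 2 T <= 3 N. *)
    { set (nb := ((M - N) / T + 1)%nat).
      assert (D1 : (M - N <= nb * T)%nat).
      { unfold nb. pose proof (Nat.div_mod_eq (M - N) T).
        pose proof (Nat.mod_upper_bound (M - N) T ltac:(lia)). nia. }
      assert (D2 : (nb * T <= M - N + T)%nat).
      { unfold nb. pose proof (Nat.div_mod_eq (M - N) T). nia. }
      assert (HT' : 1 <= INR T) by (apply (le_INR 1); lia).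
      assert (D3 : INR nb <= X / INR T + 1).
      { apply Rmult_le_reg_r with (INR T); [lra|].
        replace ((X / INR T + 1) * INR T) with (X + INR T) by (field; lra).
        rewrite <- mult_INR. unfold X. rewrite <- plus_INR. apply le_INR. lia. }
      assert (D4 : INR (nb * T) <= 2 * X).
      { unfold X. change 2 with (INR 2). rewrite <- mult_INR. apply le_INR. lia. }
      eapply Rle_trans; [apply (rsum_le_widen _ (nb * T)); [assumption|intros; apply ind_bounds]|].
      eapply Rle_trans; [apply (near_int_count f N nb T (k / 4) k s); [lra|lra|]|].
      { intros n Hn. apply HD2. lia. }
      apply Rplus_le_compat; [assumption|]. apply Rmult_le_compat_l; [lra|].
      replace (k / (k / 4)) with 4 by (field; lra).
      replace (12 * s / (k / 4)) with (48 * r ^ 2) by (rewrite <- Hr; field; lra).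
      pose proof (pos_INR (nb * T)).
      assert (INR (nb * T) * (s * 4) <= 2 * X * (s * 4)) by (apply Rmult_le_compat_r; lra).
      assert (INR (nb * T) * (INR T * k) <= 2 * X * (INR T * k)).
      { apply Rmult_le_compat_r; [|assumption]. apply Rmult_le_pos; lra. }
      assert (0 <= r ^ 2) by apply pow2_ge_0. lra. }
    assert (HIc : INR I * (INR Q * (C * q ^ (l - 1) * F) / INR P) <= 12 * C * q ^ (l - 1) * X).
    { assert (Hql : 0 < q ^ (l - 1)) by (apply pow_lt; lra).
      assert (HF0 : 0 < F) by lra.
      assert (Hnum : 0 <= C * q ^ (l - 1) * F) by (repeat apply Rmult_le_pos; lra).
      assert (E : INR Q * (C * q ^ (l - 1) * F) / INR P <= C * q ^ (l - 1) * (r / 2)).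
      { apply Rmult_le_reg_r with (INR P); [lra|].
        unfold Rdiv at 1. rewrite Rmult_assoc, Rinv_l, Rmult_1_r by lra.
        apply Rle_trans with (C * q ^ (l - 1) * (INR Q * (A * r / 4))).
        - replace (INR Q * (C * q ^ (l - 1) * F)) with (C * q ^ (l - 1) * (INR Q * F)) by ring.
          apply Rmult_le_compat_l; [apply Rmult_le_pos; lra|]. apply Rmult_le_compat_l; lra.
        - rewrite (Rmult_assoc _ (r / 2)). apply Rmult_le_compat_l; [apply Rmult_le_pos; lra|].
          nra. }
      apply Rle_trans with (24 * (X / r) * (C * q ^ (l - 1) * (r / 2))).
      - apply Rmult_le_compat; [apply pos_INR| |assumption|assumption].
        apply Rle_mult_inv_pos; [apply Rmult_le_pos|]; lra.
      - right. field. lra. }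
    split; [lia|]. split; [assumption|]. split; [assumption|]. split.
    + pose proof (harm_nonneg K) as HH.
      assert (HKN : harm K <= harm N).
      { apply rsum_le_widen; [apply INR_le; fold X; lra|].
        intros; left; apply Rinv_0_lt_compat, lt_0_INR; lia. }
      set (h := 7 + 2 * harm K) in *. set (h' := 7 + 2 * harm N).
      assert (Hhh : 0 < h <= h') by (unfold h, h'; lra).
      rewrite mult_INR in ZZ. fold F in ZZ.
      assert (HQ0 : 0 < INR Q) by lra.
      assert (HmR : 1 <= INR m) by (apply (le_INR 1); lia).
      (* Here 434 = 2 (216 + 1). Then 24 * 434 / 4 = 2604, and 2604 * 64 / 2 = 83328, where the last
         division uses K <= r/2. *)
      assert (E1 : (s * INR Q / (8 * INR K)) ^ 2 * (INR K * z ^ 2)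
         <= 24 * (X / r) * (434 * INR m * ((A * INR Q) * (A * r / 4) * INR Q * h'))).
      { apply Rle_trans with (INR W ^ 2 * (INR K * z ^ 2)).
        - apply Rmult_le_compat_r; [apply Rmult_le_pos; [lra|apply pow2_ge_0]|].
          apply pow_incr. split; [|assumption]. apply Rle_mult_inv_pos; [|lra].
          apply Rmult_le_pos; lra.
        - replace (INR W ^ 2 * (INR K * z ^ 2)) with (INR W * (INR W * INR K * z ^ 2)) by ring.
          eapply Rle_trans; [exact ZZ|].
          assert (E2 : INR P * F * INR Q * h <= A * INR Q * (A * r / 4) * INR Q * h').
          { apply Rmult_le_compat; [| lra | |lra].
            - repeat apply Rmult_le_pos; lra.
            - apply Rmult_le_compat_r; [lra|]. apply Rmult_le_compat; lra. }
          assert (E3 : 0 <= INR P * F * INR Q * h) by (repeat apply Rmult_le_pos; lra).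
          apply Rmult_le_compat; [apply pos_INR| |assumption|].
          + repeat apply Rmult_le_pos; lra.
          + replace ((216 + 1) * (INR m * (2 * (INR P * F * INR Q * h))))
              with (434 * INR m * (INR P * F * INR Q * h)) by ring.
            apply Rmult_le_compat_l; lra. }
      replace ((s * INR Q / (8 * INR K)) ^ 2 * (INR K * z ^ 2))
        with (z ^ 2 * (s ^ 2 * INR Q ^ 2 / (64 * INR K))) in E1 by (field; lra).
      replace (24 * (X / r) * (434 * INR m * ((A * INR Q) * (A * r / 4) * INR Q * h')))
        with (2604 * INR m * X * A ^ 2 * INR Q ^ 2 * h') in E1 by (field; lra).
      assert (Hs2 : 0 < s ^ 2) by (apply pow_lt; lra).
      assert (HQ2 : 0 < INR Q ^ 2) by (apply pow_lt; lra).
      apply Rmult_le_reg_r with (s ^ 2 * INR Q ^ 2 / (64 * INR K)).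
      * apply Rdiv_lt_0_compat; [apply Rmult_lt_0_compat; assumption|lra].
      * eapply Rle_trans; [exact E1|].
        replace (83328 * INR m * (X * A ^ 2 * r * h' / s ^ 2) * (s ^ 2 * INR Q ^ 2 / (64 * INR K)))
          with (1302 * INR m * X * A ^ 2 * INR Q ^ 2 * h' * (r / INR K)) by (field; lra).
        assert (2 <= r / INR K).
        { apply Rmult_le_reg_r with (INR K); [lra|].
          unfold Rdiv. rewrite Rmult_assoc, Rinv_l by lra. lra. }
        assert (0 <= 1302 * INR m * X * A ^ 2 * INR Q ^ 2 * h').
        { repeat apply Rmult_le_pos; try lra; apply pow2_ge_0. }
        nra.
    + eapply Rle_trans; [exact ZB|]. lra.
Qed.

(** * The sequence n^c *)

Lemma Rpower_pos (x e : R) : 0 < Rpower x e.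
Proof. apply exp_pos. Qed.

Lemma Rpower_le_l_neg (x y e : R) : 0 < x <= y -> e <= 0 -> Rpower y e <= Rpower x e.
Proof.
  intros H He. replace e with (- - e) by ring. rewrite !(Rpower_Ropp _ (- e)).
  apply Rinv_le_contravar; [apply Rpower_pos|]. apply Rle_Rpower_l; lra.
Qed.

Lemma Rpower_diff (x c : R) : 0 < x ->
  exists xi, x < xi < x + 1 /\ Rpower (x + 1) c - Rpower x c = c * Rpower xi (c - 1).
Proof.
  intros Hx.
  destruct (MVT_cor2 (fun t => Rpower t c) (fun t => c * Rpower t (c - 1)) x (x + 1))
    as (xi & H1 & H2); [lra| |].
  - intros t Ht. apply derivable_pt_lim_power; lra.
  - exists xi. split; [assumption|]. rewrite H1. ring.
Qed.

Lemma Rpower_diff2 (x c : R) : 0 < x ->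
  exists xi, x < xi < x + 2 /\
  Rpower (x + 2) c - 2 * Rpower (x + 1) c + Rpower x c = c * (c - 1) * Rpower xi (c - 2).
Proof.
  intros Hx.
  destruct (MVT_cor2 (fun t => Rpower (t + 1) c - Rpower t c)
     (fun t => c * Rpower (t + 1) (c - 1) - c * Rpower t (c - 1)) x (x + 1))
    as (y & H1 & H2); [lra| |].
  - intros t Ht. apply derivable_pt_lim_minus.
    + replace (c * Rpower (t + 1) (c - 1)) with (c * Rpower (t + 1) (c - 1) * 1) by ring.
      apply (derivable_pt_lim_comp (fun t => t + 1) (fun u => Rpower u c)).
      * assert (D : derivable_pt_lim (id + fct_cte 1)%F t (1 + 0))
          by (apply derivable_pt_lim_plus; [apply derivable_pt_lim_id|apply derivable_pt_lim_const]).
        rewrite Rplus_0_r in D. exact D.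
      * apply derivable_pt_lim_power; lra.
    + apply derivable_pt_lim_power; lra.
  - destruct (Rpower_diff y (c - 1)) as (xi & K1 & K2); [lra|].
    replace (c - 1 - 1) with (c - 2) in K2 by ring.
    exists xi. split; [lra|].
    replace (x + 2) with (x + 1 + 1) by ring.
    replace (Rpower (x + 1 + 1) c - 2 * Rpower (x + 1) c + Rpower x c)
      with (Rpower (x + 1 + 1) c - Rpower (x + 1) c - (Rpower (x + 1) c - Rpower x c)) by ring.
    rewrite H1, <- Rmult_minus_distr_l, K2. ring.
Qed.

Lemma Rpower_ge_1 (x e : R) : 1 <= x -> 0 <= e -> 1 <= Rpower x e.
Proof. intros Hx He. rewrite <- (Rpower_O x) by lra. apply Rle_Rpower; lra. Qed.

Lemma Rpower_eventually_ge (B e : R) : 0 < e ->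
  exists X0, forall X, X0 <= X -> B <= Rpower X e.
Proof.
  intros He. exists (Rpower (Rmax 1 B) (/ e)). intros X HX.
  apply Rle_trans with (Rmax 1 B); [apply Rmax_r|].
  assert (H1 : 0 < Rmax 1 B) by (pose proof (Rmax_l 1 B); lra).
  apply Rle_trans with (Rpower (Rpower (Rmax 1 B) (/ e)) e).
  - rewrite Rpower_mult, Rinv_l, Rpower_1 by lra. lra.
  - apply Rle_Rpower_l; [lra|]. split; [apply Rpower_pos|assumption].
Qed.

Lemma ln_le_Rpower (x e : R) : 0 < x -> 0 < e -> ln x <= Rpower x e / e.
Proof.
  intros Hx He. apply Rmult_le_reg_l with e; [assumption|].
  replace (e * (Rpower x e / e)) with (Rpower x e) by (field; lra).
  unfold Rpower. pose proof (exp_ineq1_le (e * ln x)). lra.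
Qed.

Lemma harm_le_ln (n : nat) : (1 <= n)%nat -> harm n <= 1 + ln (INR n).
Proof.
  induction n as [|n IH]; intros Hn; [lia|].
  destruct (Nat.eq_dec n 0) as [->|Hn0].
  - unfold harm. simpl. rewrite ln_1. lra.
  - specialize (IH ltac:(lia)). unfold harm in *. cbn [rsum].
    assert (H : 0 < INR n) by (apply lt_0_INR; lia).
    assert (HS : 0 < INR (S n)) by (apply lt_0_INR; lia).
    assert (E : ln (INR n) = ln (INR (S n)) + ln (INR n / INR (S n))).
    { rewrite <- ln_mult; [f_equal; field; lra|assumption|]. apply Rdiv_lt_0_compat; assumption. }
    assert (L : ln (INR n / INR (S n)) <= - / INR (S n)).
    { assert (H0 : 0 < INR n / INR (S n)) by (apply Rdiv_lt_0_compat; assumption).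
      pose proof (exp_ineq1_le (ln (INR n / INR (S n)))) as G. rewrite exp_ln in G by assumption.
      replace (- / INR (S n)) with (INR n / INR (S n) - 1); [lra|].
      rewrite S_INR in *. field. lra. }
    lra.
Qed.

(** The intermediate point is at most 3 N and c - 1 < 1/3, so slopes vary by at most 3^(1/3) <= 3/2.
    A factor below 2 keeps all moduli in one range [P, 2P). *)
Lemma Rpower_diff_bounds (c : R) (N n : nat) : 1 < c < 4 / 3 -> (1 <= N)%nat ->
  (N <= n <= 2 * N)%nat ->
  c * Rpower (INR N) (c - 1) <= Rpower (INR (S n)) c - Rpower (INR n) c
  <= 3 / 2 * (c * Rpower (INR N) (c - 1)).
Proof.
  intros Hc HN Hn.
  assert (HX : 1 <= INR N) by (apply (le_INR 1); lia).
  assert (H1 : INR N <= INR n) by (apply le_INR; lia).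
  assert (H2 : INR n <= 2 * INR N)
    by (change 2 with (INR 2); rewrite <- mult_INR; apply le_INR; lia).
  rewrite S_INR. destruct (Rpower_diff (INR n) c) as (xi & K1 & K2); [lra|].
  rewrite K2. split.
  - apply Rmult_le_compat_l; [lra|]. apply Rle_Rpower_l; lra.
  - replace (3 / 2 * (c * Rpower (INR N) (c - 1)))
      with (c * (3 / 2 * Rpower (INR N) (c - 1))) by ring.
    apply Rmult_le_compat_l; [lra|].
    apply Rle_trans with (Rpower (3 * INR N) (c - 1)); [apply Rle_Rpower_l; lra|].
    rewrite <- Rpower_mult_distr by lra.
    apply Rmult_le_compat_r; [left; apply Rpower_pos|].
    apply Rle_trans with (Rpower 3 (/ 3)); [apply Rle_Rpower; lra|].
    apply Rle_trans with (Rpower (Rpower (3 / 2) 3) (/ 3)).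
    + apply Rle_Rpower_l; [lra|]. split; [lra|].
      replace 3 with (INR 3) at 3 by (simpl; ring). rewrite Rpower_pow by lra. lra.
    + rewrite Rpower_mult, Rinv_r, Rpower_1 by lra. lra.
Qed.

Lemma Rpower_diff2_bounds (c : R) (N n : nat) : 1 < c < 4 / 3 -> (1 <= N)%nat ->
  (N <= n < 3 * N)%nat ->
  c * (c - 1) * Rpower (INR N) (c - 2) / 4
  <= Rpower (INR (S (S n))) c - 2 * Rpower (INR (S n)) c + Rpower (INR n) c
  <= c * (c - 1) * Rpower (INR N) (c - 2).
Proof.
  intros Hc HN Hn.
  assert (HX : 1 <= INR N) by (apply (le_INR 1); lia).
  assert (H1 : INR N <= INR n) by (apply le_INR; lia).
  assert (H2 : INR n + 1 <= 3 * INR N).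
  { rewrite <- S_INR. replace 3 with (INR 3) by (simpl; ring).
    rewrite <- mult_INR. apply le_INR; lia. }
  replace (INR (S (S n))) with (INR n + 2) by (rewrite !S_INR; ring). rewrite S_INR.
  destruct (Rpower_diff2 (INR n) c) as (xi & K1 & K2); [lra|]. rewrite K2.
  assert (Hcc : 0 < c * (c - 1)) by (apply Rmult_lt_0_compat; lra). split.
  - unfold Rdiv. rewrite Rmult_assoc. apply Rmult_le_compat_l; [lra|].
    apply Rle_trans with (Rpower (4 * INR N) (c - 2)).
    + rewrite <- Rpower_mult_distr, Rmult_comm by lra.
      apply Rmult_le_compat_r; [left; apply Rpower_pos|].
      apply Rle_trans with (Rpower 4 (- (1))); [|apply Rle_Rpower; lra].
      rewrite Rpower_Ropp, Rpower_1 by lra. lra.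
    + apply Rpower_le_l_neg; lra.
  - apply Rmult_le_compat_l; [lra|]. apply Rpower_le_l_neg; lra.
Qed.

Lemma Rpower_floor_dyadic (m a : nat) (c : R) : (1 <= m)%nat -> 1 < c < 4 / 3 ->
  exists C eps X0 : R, 0 < C /\ 0 < eps <= 1 / 2 /\
  forall N M, (1 <= N)%nat -> X0 <= INR N -> (N <= M <= 2 * N)%nat ->
  Rabs (rsum (M - N) (fun t => psi m a (nfloor (Rpower (INR (N + t)) c))))
  <= C * Rpower (INR N) (1 - eps).
Proof.
  intros Hm Hc.
  destruct (psi_sum_bound m Hm) as (C0 & q & HC0 & Hq & Hpsi).
  (* With [s = N^(-d)], the dispersion term [z] is of order [N^(3c/4 + d)] at most, that is,
     [N^(1 - d)] for this choice of [d]. *)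
  set (d := (4 - 3 * c) / 8).
  assert (Hd : 0 < d < 1 / 8) by (unfold d; lra).
  assert (Ec : c = (4 - 8 * d) / 3) by (unfold d; lra).
  (* So q = 2^(-eta), which with fib l <= 2^(l-1) turns q^(l-1) into a negative power of fib l. *)
  set (eta := - ln q / ln 2).
  assert (Hln2 : 0 < ln 2) by (rewrite <- ln_1; apply ln_increasing; lra).
  assert (Hlnq : ln q < 0) by (rewrite <- ln_1; apply ln_increasing; lra).
  assert (Heta : 0 < eta) by (apply Rdiv_lt_0_compat; lra).
  set (eps := Rmin (d / 4) (eta / 4)).
  assert (Heps : 0 < eps /\ eps <= d / 4 /\ eps <= eta / 4).
  { unfold eps. split; [apply Rmin_glb_lt; lra|]. split; [apply Rmin_l|apply Rmin_r]. }
  set (k0 := c * (c - 1)).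
  assert (Hk0 : 0 < k0) by (apply Rmult_lt_0_compat; lra).
  set (r0 := / sqrt k0).
  assert (Hr0 : 0 < r0) by (apply Rinv_0_lt_compat, sqrt_lt_R0; assumption).
  assert (Hr0k : r0 ^ 2 * k0 = 1).
  { unfold r0. rewrite pow_inv, pow2_sqrt by lra. field. lra. }
  (* The solution of 2 rho + (c - 2) = -d, that is, r^2 k = s in exponents. *)
  set (rho := (2 - c - d) / 2).
  destruct (Rpower_eventually_ge (24 / r0) rho) as [X1 HX1]; [unfold rho; lra|].
  destruct (Rpower_eventually_ge r0 (1 - rho)) as [X2 HX2]; [unfold rho; lra|].
  destruct (Rpower_eventually_ge 4 d) as [X3 HX3]; [lra|].
  destruct (Rpower_eventually_ge (8 * r0) (2 - d - rho)) as [X4 HX4]; [unfold rho; lra|].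
  destruct (Rpower_eventually_ge 2 (d / 4)) as [X5 HX5]; [lra|].
  destruct (Rpower_eventually_ge 2 (1 - d / 4)) as [X6 HX6]; [lra|].
  destruct (Rpower_eventually_ge (8 / (c * r0)) (c - 1 + rho - 1 / 4)) as [X7 HX7];
    [unfold rho; lra|].
  set (Cz := 83328 * INR m * (c ^ 2 * r0 * (9 + 4 / d))).
  set (C := 2 * (3 + 64 + 4 * k0 + 384 * r0 ^ 2 + 6) + 24 / r0 + 12 * C0 + (Cz + 1) + r0).
  assert (HCz : 0 < Cz).
  { unfold Cz. assert (0 < INR m) by (apply lt_0_INR; lia).
    assert (0 < 4 / d) by (apply Rdiv_lt_0_compat; lra).
    repeat apply Rmult_lt_0_compat; try lra; apply pow_lt; lra. }
  assert (Hr02 : 0 < r0 ^ 2) by (apply pow_lt; assumption).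
  assert (H24 : 0 < 24 / r0) by (apply Rdiv_lt_0_compat; lra).
  exists C, eps, (Rmax X1 (Rmax X2 (Rmax X3 (Rmax X4 (Rmax X5 (Rmax X6 X7)))))).
  split; [unfold C; lra|]. split; [lra|].
  intros N M HN HX HNM. set (X := INR N) in *.
  assert (HXs : X1 <= X /\ X2 <= X /\ X3 <= X /\ X4 <= X /\ X5 <= X /\ X6 <= X /\ X7 <= X).
  {
    pose proof (Rmax_l X1 (Rmax X2 (Rmax X3 (Rmax X4 (Rmax X5 (Rmax X6 X7)))))).
    pose proof (Rmax_r X1 (Rmax X2 (Rmax X3 (Rmax X4 (Rmax X5 (Rmax X6 X7)))))).
    pose proof (Rmax_l X2 (Rmax X3 (Rmax X4 (Rmax X5 (Rmax X6 X7))))).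
    pose proof (Rmax_r X2 (Rmax X3 (Rmax X4 (Rmax X5 (Rmax X6 X7))))).
    pose proof (Rmax_l X3 (Rmax X4 (Rmax X5 (Rmax X6 X7)))).
    pose proof (Rmax_r X3 (Rmax X4 (Rmax X5 (Rmax X6 X7)))).
    pose proof (Rmax_l X4 (Rmax X5 (Rmax X6 X7))). pose proof (Rmax_r X4 (Rmax X5 (Rmax X6 X7))).
    pose proof (Rmax_l X5 (Rmax X6 X7)). pose proof (Rmax_r X5 (Rmax X6 X7)).
    pose proof (Rmax_l X6 X7). pose proof (Rmax_r X6 X7). lra. }
  destruct HXs as (G1 & G2 & G3 & G4 & G5 & G6 & G7).
  specialize (HX1 X G1). specialize (HX2 X G2). specialize (HX3 X G3). specialize (HX4 X G4).
  specialize (HX5 X G5). specialize (HX6 X G6). specialize (HX7 X G7).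
  assert (HX0 : 1 <= X) by (apply (le_INR 1); lia).
  assert (Hp : forall e, 0 < Rpower X e) by (intros; apply Rpower_pos).
  assert (Hadd : forall e e', Rpower X e * Rpower X e' = Rpower X (e + e'))
    by (intros; symmetry; apply Rpower_plus).
  assert (Hle : forall e e', e <= e' -> Rpower X e <= Rpower X e')
    by (intros; apply Rle_Rpower; assumption).
  assert (HX' : Rpower X 1 = X) by (apply Rpower_1; lra).
  set (s := Rpower X (- d)). set (A := c * Rpower X (c - 1)).
  set (k := k0 * Rpower X (c - 2)). set (r := r0 * Rpower X rho).
  (* A small power balances the count of near-integers: the windows cost X / T, while the pairs cost
     about T X s, of order X^(1 - 3 d / 4). *)
  set (T := nfloor (Rpower X (d / 4))).
  pose proof (nfloor_bounds (Rpower X (d / 4)) ltac:(left; apply Hp)) as HT. fold T in HT.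
  set (Y := Rpower X (1 - eps)).
  destruct (explicit_bound m N M T a (fun n => Rpower (INR n) c) A k s r C0 q)
    as (l & z & Hl & HF & Hz0 & Hz & HS); try assumption.
  - apply INR_le. simpl (INR 1). lra.
  - apply INR_le. rewrite mult_INR. simpl (INR 2). fold X.
    apply Rle_trans with (Rpower X (1 - d / 4) * Rpower X (d / 4)).
    + apply Rmult_le_compat; [lra|apply pos_INR|assumption|lra].
    + rewrite Hadd. replace (1 - d / 4 + d / 4) with 1 by ring. lra.
  - unfold A. pose proof (Rpower_ge_1 X (c - 1) HX0 ltac:(lra)). nra.
  - apply Rmult_lt_0_compat; [assumption|apply Hp].
  - split; [apply Hp|]. unfold s. rewrite Rpower_Ropp.
    replace (1 / 4) with (/ 4) by field. apply Rinv_le_contravar; lra.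
  - unfold r, k, s. rewrite Rpow_mult_distr. simpl (Rpower X rho ^ 2). rewrite Rmult_1_r, Hadd.
    replace (r0 ^ 2 * Rpower X (rho + rho) * (k0 * Rpower X (c - 2)))
      with (r0 ^ 2 * k0 * (Rpower X (rho + rho) * Rpower X (c - 2))) by ring.
    rewrite Hr0k, Hadd, Rmult_1_l. f_equal. unfold rho. field.
  - split.
    + unfold r. apply Rmult_le_reg_l with (/ r0); [apply Rinv_0_lt_compat; assumption|].
      rewrite <- Rmult_assoc, Rinv_l by lra. lra.
    + unfold r. fold X. rewrite <- HX' at 2. replace 1 with ((1 - rho) + rho) by ring.
      rewrite <- Hadd. apply Rmult_le_compat_r; [left; apply Hp|assumption].
  - unfold r, s. fold X. replace (X ^ 2) with (Rpower X 2).
    + rewrite Hadd. replace (- d + 2) with ((2 - d - rho) + rho) by ring. rewrite <- Hadd.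
      rewrite <- Rmult_assoc. apply Rmult_le_compat_r; [left; apply Hp|assumption].
    + replace 2 with (INR 2) by reflexivity. apply Rpower_pow. lra.
  - apply Rpower_pos.
  - intros n Hn. apply Rpower_diff_bounds; assumption.
  - intros n Hn. apply Rpower_diff2_bounds; assumption.
  - fold X in Hz, HS. eapply Rle_trans; [exact HS|].
    assert (HT1 : 1 <= INR T) by lra.
    assert (B1 : X / INR T <= 2 * Y).
    { apply Rmult_le_reg_r with (INR T); [lra|].
      unfold Rdiv. rewrite Rmult_assoc, Rinv_l, Rmult_1_r by lra.
      apply Rle_trans with (2 * Rpower X (1 - d / 4) * (Rpower X (d / 4) / 2)).
      - replace (2 * Rpower X (1 - d / 4) * (Rpower X (d / 4) / 2))
          with (Rpower X (1 - d / 4) * Rpower X (d / 4)) by field.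
        rewrite Hadd. replace (1 - d / 4 + d / 4) with 1 by ring. lra.
      - apply Rmult_le_compat; [pose proof (Hp (1 - d / 4)); lra|lra| |lra].
        apply Rmult_le_compat_l; [lra|]. apply Hle; lra. }
    assert (B2 : 1 <= Y) by (apply Rpower_ge_1; lra).
    assert (B3 : INR T * (X * s) <= Y).
    { apply Rle_trans with (Rpower X (d / 4) * (Rpower X 1 * s)).
      - rewrite HX'. apply Rmult_le_compat_r; [|lra]. apply Rmult_le_pos; [lra|left; apply Hp].
      - unfold s. rewrite !Hadd. apply Hle. lra. }
    assert (B4 : INR T * (X * INR T * k) <= k0 * Y).
    { apply Rle_trans with (Rpower X (d / 4) * (Rpower X 1 * Rpower X (d / 4) * k)).
      - rewrite HX'. assert (0 < k) by (apply Rmult_lt_0_compat; [assumption|apply Hp]).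
        assert (X * INR T * k <= X * Rpower X (d / 4) * k).
        { apply Rmult_le_compat_r; [lra|]. apply Rmult_le_compat_l; lra. }
        apply Rmult_le_compat; try lra. apply Rmult_le_pos; [apply Rmult_le_pos|]; lra.
      - unfold k. replace (Rpower X (d / 4) * (Rpower X 1 * Rpower X (d / 4) * (k0 * Rpower X (c - 2))))
          with (k0 * (Rpower X (d / 4) * (Rpower X 1 * (Rpower X (d / 4) * Rpower X (c - 2))))) by ring.
        rewrite !Hadd. apply Rmult_le_compat_l; [lra|]. apply Hle. lra. }
    assert (B5 : INR T * r ^ 2 <= r0 ^ 2 * Y).
    { apply Rle_trans with (Rpower X (d / 4) * r ^ 2).
      - apply Rmult_le_compat_r; [apply pow2_ge_0|lra].
      - unfold r. replace (Rpower X (d / 4) * (r0 * Rpower X rho) ^ 2)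
          with (r0 ^ 2 * (Rpower X (d / 4) * (Rpower X rho * Rpower X rho))) by ring.
        rewrite !Hadd. apply Rmult_le_compat_l; [lra|]. apply Hle. unfold rho. lra. }
    assert (B6 : INR T <= Y).
    { apply Rle_trans with (Rpower X (d / 4)); [lra|]. apply Hle. lra. }
    assert (B7 : 24 * (X / r) <= 24 / r0 * Y).
    { replace (24 * (X / r)) with (24 / r0 * Rpower X (1 - rho)).
      - apply Rmult_le_compat_l; [lra|]. apply Hle. unfold rho. lra.
      - unfold r. replace (Rpower X (1 - rho)) with (X / Rpower X rho).
        + field. split; [apply Rgt_not_eq, Hp|lra].
        + unfold Rdiv. rewrite <- Rpower_Ropp. rewrite <- HX' at 1. rewrite Hadd. reflexivity. }
    assert (B8 : 12 * C0 * q ^ (l - 1) * X <= 12 * C0 * Y).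
    { rewrite (Rmult_assoc (12 * C0)). apply Rmult_le_compat_l; [lra|].
      (* The block length has order X^(c/2 - d/2), whose exponent exceeds 7/16; 1/4 is a convenient
         smaller value. *)
      assert (F1 : Rpower X (1 / 4) <= INR (fib l)).
      { eapply Rle_trans; [|exact HF]. unfold A, r.
        replace (c * Rpower X (c - 1) * (r0 * Rpower X rho) / 8)
          with (c * r0 / 8 * (Rpower X (c - 1) * Rpower X rho)) by field.
        rewrite Hadd. replace (c - 1 + rho) with ((c - 1 + rho - 1 / 4) + 1 / 4) by ring.
        rewrite <- Hadd. rewrite <- Rmult_assoc, <- (Rmult_1_l (Rpower X (1 / 4))) at 1.
        apply Rmult_le_compat_r; [left; apply Hp|].
        apply Rle_trans with (c * r0 / 8 * (8 / (c * r0))).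
        - right. field. split; lra.
        - apply Rmult_le_compat_l; [|assumption]. assert (0 < c * r0) by (apply Rmult_lt_0_compat; lra).
          lra. }
      assert (F2 : INR (fib l) <= 2 ^ (l - 1)).
      { pose proof (fib_le_pow2 1 (l - 1) ltac:(lia)) as H.
        replace (1 + (l - 1))%nat with l in H by lia. change (fib 1) with 1%nat in H.
        rewrite Nat.mul_1_r in H. apply le_INR in H. rewrite pow_INR in H. exact H. }
      assert (F3 : q ^ (l - 1) = Rpower (2 ^ (l - 1)) (- eta)).
      { rewrite <- !Rpower_pow by lra. rewrite Rpower_mult. unfold Rpower. f_equal.
        unfold eta. field. lra. }
      assert (F4 : q ^ (l - 1) <= Rpower X (- (eta / 4))).
      { rewrite F3. apply Rle_trans with (Rpower (Rpower X (1 / 4)) (- eta)).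
        - apply Rpower_le_l_neg; [|lra]. split; [apply Hp|lra].
        - rewrite Rpower_mult. apply Hle. lra. }
      apply Rle_trans with (Rpower X (- (eta / 4)) * Rpower X 1).
      - rewrite HX'. apply Rmult_le_compat_r; lra.
      - rewrite Hadd. apply Hle. lra. }
    assert (B9 : z <= (Cz + 1) * Y).
    { assert (F1 : 7 + 2 * harm N <= (9 + 4 / d) * Rpower X (d / 2)).
      { pose proof (harm_le_ln N HN) as H1. fold X in H1.
        pose proof (ln_le_Rpower X (d / 2) ltac:(lra) ltac:(lra)) as H2.
        pose proof (Rpower_ge_1 X (d / 2) HX0 ltac:(lra)) as H3.
        replace ((9 + 4 / d) * Rpower X (d / 2))
          with (9 * Rpower X (d / 2) + 2 * (Rpower X (d / 2) / (d / 2))) by (field; lra).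
        lra. }
      assert (F2 : z ^ 2 <= Cz * Rpower X (2 - 2 * d)).
      { eapply Rle_trans; [exact Hz|]. unfold Cz.
        replace (83328 * INR m * (c ^ 2 * r0 * (9 + 4 / d)) * Rpower X (2 - 2 * d))
          with (83328 * INR m * (c ^ 2 * r0 * (9 + 4 / d) * Rpower X (2 - 2 * d))) by ring.
        apply Rmult_le_compat_l; [pose proof (pos_INR m); lra|].
        apply Rle_trans with (X * A ^ 2 * r * ((9 + 4 / d) * Rpower X (d / 2)) / s ^ 2).
        - unfold Rdiv. apply Rmult_le_compat_r.
          + left. apply Rinv_0_lt_compat, pow_lt, Hp.
          + apply Rmult_le_compat_l; [|assumption].
            apply Rmult_le_pos; [apply Rmult_le_pos; [lra|apply pow2_ge_0]|].
            left. apply Rmult_lt_0_compat; [assumption|apply Hp].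
        (* Exponents: 1 + 2 (c - 1) + rho + d/2 + 2 d = 3 c / 2 + 2 d = 2 - 2 d, where d/2 absorbs
           the logarithm. *)
        - right. unfold A, r, s. rewrite <- HX' at 1.
          replace (Rpower X 1 * (c * Rpower X (c - 1)) ^ 2 * (r0 * Rpower X rho)
                   * ((9 + 4 / d) * Rpower X (d / 2)) / Rpower X (- d) ^ 2)
            with (c ^ 2 * r0 * (9 + 4 / d) * (Rpower X 1 * (Rpower X (c - 1) * (Rpower X (c - 1)
                   * (Rpower X rho * (Rpower X (d / 2) * (/ Rpower X (- d) * / Rpower X (- d))))))))
            by (field; split; [lra|apply Rgt_not_eq, Hp]).
          rewrite <- !Rpower_Ropp, !Hadd. f_equal. f_equal. unfold rho. lra. }
      assert (F3 : Rpower X (1 - d) <= Y) by (apply Hle; lra).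
      (* The bound Cz <= (Cz + 1)^2 replaces a square root. *)
      apply Rle_trans with ((Cz + 1) * Rpower X (1 - d)); [|apply Rmult_le_compat_l; lra].
      apply Rsqr_incr_0_var; [|apply Rmult_le_pos; [lra|left; apply Hp]].
      rewrite !Rsqr_pow2, Rpow_mult_distr.
      replace (Rpower X (1 - d) ^ 2) with (Rpower X (2 - 2 * d)).
      - eapply Rle_trans; [exact F2|]. apply Rmult_le_compat_r; [left; apply Hp|]. nra.
      - simpl. rewrite Rmult_1_r, Hadd. f_equal. ring. }
    assert (B10 : r <= r0 * Y).
    { apply Rmult_le_compat_l; [lra|]. apply Hle. unfold rho. lra. }
    unfold C.
    replace (2 * (X / INR T + 1 + 2 * INR T * (32 * X * s + 2 * X * INR T * k + 192 * r ^ 2 + 3)))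
      with (2 * (X / INR T + 1 + 64 * (INR T * (X * s)) + 4 * (INR T * (X * INR T * k))
              + 384 * (INR T * r ^ 2) + 6 * INR T)) by ring.
    lra.
Qed.

(** Induction by halving: since eps <= 1/2, the half range contributes at most 3/4 of the claimed
    bound, and [D] is at least 4 C, so the dyadic range fits into the remaining quarter. The other
    lower bound on [D] settles small [M] trivially. *)
Lemma Rpower_floor_sum (m a : nat) (c : R) : (1 <= m)%nat -> 1 < c < 4 / 3 ->
  exists C eps : R, 0 < C /\ 0 < eps <= 1 / 2 /\
  forall M, (1 <= M)%nat ->
  Rabs (rsum M (fun t => psi m a (nfloor (Rpower (INR (S t)) c)))) <= C * Rpower (INR M) (1 - eps).
Proof.
  intros Hm Hc.
  destruct (Rpower_floor_dyadic m a c Hm Hc) as (C & eps & X0 & HC & Heps & H).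
  pose proof (nfloor_bounds (Rmax 0 X0) (Rmax_l _ _)) as HN0.
  pose proof (Rmax_r 0 X0) as HX0. set (N0 := S (nfloor (Rmax 0 X0))).
  assert (HN0' : X0 <= INR N0) by (unfold N0; rewrite S_INR; lra).
  set (D := Rmax (4 * C) (INR (2 * N0))).
  assert (HD1 : 4 * C <= D) by apply Rmax_l. assert (HD2 : INR (2 * N0) <= D) by apply Rmax_r.
  exists D, eps. split; [lra|]. split; [assumption|].
  set (g := fun n => psi m a (nfloor (Rpower (INR n) c))).
  change (forall M, (1 <= M)%nat -> Rabs (rsum M (fun t => g (S t))) <= D * Rpower (INR M) (1 - eps)).
  assert (Hsqrt : Rpower (1 / 2) (1 - eps) <= 3 / 4).
  { apply Rle_trans with (Rpower (Rpower (3 / 4) 2) (1 - eps)).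
    - apply Rle_Rpower_l; [lra|]. split; [lra|].
      replace 2 with (INR 2) at 2 by reflexivity. rewrite Rpower_pow by lra. simpl. lra.
    - rewrite Rpower_mult. apply Rle_trans with (Rpower (3 / 4) 1); [|rewrite Rpower_1; lra].
      destruct (Req_dec (2 * (1 - eps)) 1) as [E|E]; [rewrite E; lra|].
      left. apply exp_increasing.
      assert (ln (3 / 4) < 0) by (rewrite <- ln_1; apply ln_increasing; lra). nra. }
  induction M as [M IH] using lt_wf_ind. intros HM.
  assert (HM1 : 1 <= INR M) by (apply (le_INR 1); lia).
  destruct (le_lt_dec (2 * N0) M) as [L|L].
  - set (h := (M / 2)%nat).
    assert (Hh : (2 * h <= M <= 2 * h + 1)%nat).
    { unfold h. pose proof (Nat.div_mod_eq M 2). pose proof (Nat.mod_upper_bound M 2 ltac:(lia)). lia. }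
    assert (N0 >= 1)%nat by (unfold N0; lia).
    specialize (IH h ltac:(lia) ltac:(lia)).
    (* The half-open range from h + 1 to M + 1 is dyadic because M <= 2 h + 1. *)
    specialize (H (S h) (S M) ltac:(lia)).
    assert (Hb : X0 <= INR (S h)).
    { apply Rle_trans with (INR N0); [assumption|]. apply le_INR. lia. }
    specialize (H Hb ltac:(lia)).
    assert (E : rsum M (fun t => g (S t))
      = rsum h (fun t => g (S t)) + rsum (S M - S h) (fun t => g (S h + t)%nat)).
    { replace M with (h + (M - h))%nat at 1 by lia. rewrite rsum_app. f_equal. }
    rewrite E. eapply Rle_trans; [apply Rabs_triang|].
    assert (L1 : Rpower (INR h) (1 - eps) <= 3 / 4 * Rpower (INR M) (1 - eps)).
    { assert (Hh1 : 1 <= INR h) by (apply (le_INR 1); lia).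
      assert (Hh2 : INR h <= 1 / 2 * INR M).
      { destruct Hh as [Hh _]. apply le_INR in Hh. rewrite mult_INR in Hh.
        simpl (INR 2) in Hh. lra. }
      apply Rle_trans with (Rpower (1 / 2 * INR M) (1 - eps)); [apply Rle_Rpower_l; lra|].
      rewrite <- Rpower_mult_distr by lra.
      apply Rmult_le_compat_r; [left; apply Rpower_pos|assumption]. }
    assert (L2 : Rpower (INR (S h)) (1 - eps) <= Rpower (INR M) (1 - eps)).
    { apply Rle_Rpower_l; [lra|]. split; [apply lt_0_INR; lia|apply le_INR; lia]. }
    pose proof (Rpower_pos (INR M) (1 - eps)).
    assert (D * Rpower (INR h) (1 - eps) <= D * (3 / 4 * Rpower (INR M) (1 - eps)))
      by (apply Rmult_le_compat_l; lra).
    assert (C * Rpower (INR (S h)) (1 - eps) <= C * Rpower (INR M) (1 - eps))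
      by (apply Rmult_le_compat_l; lra).
    assert (4 * C * Rpower (INR M) (1 - eps) <= D * Rpower (INR M) (1 - eps))
      by (apply Rmult_le_compat_r; lra).
    eapply Rle_trans; [apply Rplus_le_compat; [exact IH|exact H]|]. lra.
  - apply Rle_trans with (INR M); [apply psi_range_trivial; assumption|].
    assert (INR M <= INR (2 * N0)) by (apply le_INR; lia).
    pose proof (Rpower_ge_1 (INR M) (1 - eps) HM1 ltac:(lra)). nra.
Qed.

(** * From [psi] to the counting function *)

Lemma INR_length_filter_seq (q : nat -> bool) (b n : nat) :
  INR (length (filter q (seq b n))) = rsum n (fun t => ind (q (b + t)%nat)).
Proof.
  revert b. induction n as [|n IH]; intros b; [reflexivity|].
  rewrite rsum_head. cbn [seq filter]. rewrite Nat.add_0_r.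
  rewrite (rsum_ext n _ (fun t => ind (q (S b + t)%nat)))
    by (intros; rewrite Nat.add_succ_r; reflexivity).
  rewrite <- IH. destruct (q b); cbn [length]; rewrite ?S_INR; simpl ind; ring.
Qed.

Lemma Zmod_eqb_shift (m a s : Z) : (1 <= m)%Z -> (0 <= s)%Z ->
  Z.eqb (s mod m) (a mod m) = (((Z.to_nat s + Z.to_nat ((- a) mod m)) mod Z.to_nat m =? 0)%nat).
Proof.
  intros Hm Hs. pose proof (Z.mod_pos_bound (- a) m ltac:(lia)) as Hb.
  rewrite <- Z2Nat.inj_add, <- Z2Nat.inj_mod by lia.
  rewrite Z.add_mod_idemp_r by lia. replace (s + - a)%Z with (s - a)%Z by ring.
  pose proof (Z.mod_pos_bound (s - a) m ltac:(lia)) as Hc.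
  apply Bool.eq_true_iff_eq. rewrite Z.eqb_eq, Nat.eqb_eq. split; intros H.
  - rewrite Zminus_mod, H, Z.sub_diag, Z.mod_0_l by lia. reflexivity.
  - assert (H0 : ((s - a) mod m = 0)%Z) by lia.
    replace s with (a + (s - a))%Z at 1 by ring.
    rewrite Z.add_mod, H0, Z.add_0_r, Z.mod_mod by lia. reflexivity.
Qed.

Theorem theorem4 (m a : Z) (hm : (1 <= m)%Z) (c : R) (hc : 1 < c < 4 / 3) :
  exists eps : R, 0 < eps /\
  exists C : R, forall x : R, 1 <= x ->
    Rabs (INR (count_zeck m a c x) - x / IZR m) <= C * Rpower x (1 - eps).
Proof.
  (* As [psi] tests whether the digit sum plus its parameter vanishes mod m, the parameter is the
     residue of -a. *)
  set (m' := Z.to_nat m). set (a' := Z.to_nat ((- a) mod m)).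
  assert (Hm' : (1 <= m')%nat) by (unfold m'; lia).
  assert (Em : IZR m = INR m') by (unfold m'; rewrite INR_IZR_INZ, Z2Nat.id by lia; reflexivity).
  destruct (Rpower_floor_sum m' a' c Hm' hc) as (C & eps & HC & Heps & H).
  exists eps. split; [lra|]. exists (C + 1). intros x Hx.
  pose proof (nfloor_bounds x ltac:(lra)) as Hf. set (M := nfloor x) in *.
  assert (HM : (1 <= M)%nat).
  { apply Nat.lt_succ_r, Nat.succ_lt_mono, INR_lt. rewrite !S_INR. simpl (INR 0). lra. }
  assert (HM1 : 1 <= INR M) by (apply (le_INR 1); lia).
  assert (Hm1 : 1 <= INR m') by (apply (le_INR 1); lia).
  assert (E : INR (count_zeck m a c x)
    = rsum M (fun t => psi m' a' (nfloor (Rpower (INR (S t)) c))) + INR M * / INR m').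
  { unfold count_zeck. fold M. rewrite INR_length_filter_seq, <- rsum_const, <- rsum_plus.
    apply rsum_ext; intros t _. unfold psi. rewrite Zmod_eqb_shift, Nat2Z.id by lia.
    fold m' a'. rewrite Nat.add_1_l. ring. }
  rewrite E, Em.
  specialize (H M HM).
  assert (L1 : Rpower (INR M) (1 - eps) <= Rpower x (1 - eps)) by (apply Rle_Rpower_l; lra).
  assert (L2 : 1 <= Rpower x (1 - eps)) by (apply Rpower_ge_1; lra).
  assert (L3 : C * Rpower (INR M) (1 - eps) <= C * Rpower x (1 - eps))
    by (apply Rmult_le_compat_l; lra).
  (* Replacing x by its integer part in the main term costs at most 1, hence the constant C + 1. *)
  assert (L4 : 0 <= (x - INR M) * / INR m' <= 1).
  { assert (0 < / INR m') by (apply Rinv_0_lt_compat; lra).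
    assert (/ INR m' <= 1) by (rewrite <- Rinv_1; apply Rinv_le_contravar; lra).
    split; [apply Rmult_le_pos; lra|]. nra. }
  apply Rabs_le_inv in H. unfold Rdiv. apply Rabs_le. lra.
Qed.
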